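(* For any non-negative integer $n$, there exists a virtual knot $K$ whose unknotting index is $U(K)=(1,n)$.
   Context: Virtual knots. A virtual knot diagram is a generic immersion of an oriented circle into the plane whose finitely many transverse double points are each either a real crossing (equipped with over/under information) or a virtual crossing (marked by a small circle, with no over/under information). The word ''crossing'' without qualifier means real crossing. A virtual knot is an equivalence class of such diagrams under planar isotopy, the classical Reidemeister moves RI, RII, RIII (on real crossings), the virtual moves VRI, VRII, VRIII (the same moves with all crossings virtual), and the mixed move VRIV (an arc all of whose crossings in the move are virtual is moved across a real crossing). The trivial knot is the virtual knot presented by a diagram with no crossings. Unknotting index. For non-negative integers $m,n$, a diagram $D$ is $(m,n)$-unknottable if $D$ is changed into a diagram of the trivial knot by changing $m$ real crossings of $D$ into virtual crossings and applying crossing changes (switching over and under) on $n$ real crossings of $D$. $U(D)$ is the minimum, with respect to the dictionary (lexicographic) order, of all pairs $(m,n)$ such that $D$ is $(m,n)$-unknottable; $U(K)$ is the minimum (in the dictionary order) of $U(D)$ over all diagrams $D$ presenting $K$. *)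

(* Defs.v *)
From Stdlib Require Export Relation_Operators.
From mathcomp Require Export all_boot all_order.

Set Implicit Arguments.
Unset Strict Implicit.
Unset Printing Implicit Defensive.

(* A generic closed curve in the plane, up to planar isotopy, is its oriented
   4-valent plane graph.  It is encoded by the cyclic sequence of its passages
   through the double points (real and virtual alike), together with the planar
   position of the two strands at each double point, subject to Euler's formula.

   The passage [(c, b)] is the visit of the double point [c] by the strand that
   sees the other one cross it from right to left if [b], and from left to
   right otherwise.  The other visit of [c] is thus [(c, ~~ b)]. *)
Definition passage : Type := (nat * bool)%type.

Definition mate (p : passage) : passage := (p.1, ~~ p.2).

Definition gauss_word (w : seq passage) : bool :=
  uniq w && all (fun p => mate p \in w) w.

(* Edge sides.  [(p, true)] is the edge from [p] to [next w p], walked forwards;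
   [(p, false)] is the edge from [prev w p] to [p], walked backwards; in both
   cases the region considered is the one on the left of the walker. *)
Definition dart : Type := (passage * bool)%type.

(* Arriving at the passage [p], forwards iff [d], the walker turns left. *)
Definition turn (p : passage) (d : bool) : dart := (mate p, p.2 == d).

Definition face_step (w : seq passage) (x : dart) : dart :=
  turn (if x.2 then next w x.1 else prev w x.1) x.2.

Definition darts (w : seq passage) : seq dart :=
  [seq (p, d) | p <- w, d <- [:: true; false]].

Definition nb_faces (w : seq passage) : nat :=
  n_comp (fun x y : seq_sub (darts w) => face_step w (val x) == val y) predT.

(* V - E + F = 2 with V = n, E = 2 n and size w = 2 n; the circle without
   double points is not a cellular graph and is treated apart. *)
Definition planar (w : seq passage) : bool :=
  (w == [::]) || (nb_faces w == (size w)./2 + 2).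

(* The word is read from a base point lying on an edge adjacent to the
   unbounded region, which is on the left of that edge iff [outer_left].
   [kind c] is [None] if [c] is virtual, and [Some o] if [c] is a real crossing
   whose over-passage is [(c, o)]; its value outside the word is irrelevant. *)
Record diagram : Type := Diagram {
  word : seq passage;
  kind : nat -> option bool;
  outer_left : bool;
  word_gauss : gauss_word word;
  word_planar : planar word
}.

Definition same_kinds (w : seq passage) (D D' : diagram) : Prop :=
  forall p, p \in w -> kind D p.1 = kind D' p.1.

(* The unbounded region, seen from the base edge, which goes from the last
   passage of [p :: w] to [p]. *)
Definition outer_dart (p : passage) (w : seq passage) (left : bool) : dart :=
  if left then (last p w, true) else (p, false).

(* Planar isotopy: the only freedom in the encoding is the naming of the double
   points and the choice of a base point on the boundary of the unbounded
   region. *)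
Variant planar_isotopy (D D' : diagram) : Prop :=
| Relabel (f : nat -> nat) of
    injective f
  & word D' = [seq (f p.1, p.2) | p <- word D]
  & (forall p, p \in word D -> kind D' (f p.1) = kind D p.1)
  & outer_left D' = outer_left D
| Rebase (i : nat) (p q : passage) (u v : seq passage) of
    word D = p :: u
  & word D' = q :: v
  & word D' = rot i (word D)
  & same_kinds (word D) D D'
  & (exists j, iter j (face_step (word D)) (outer_dart p u (outer_left D))
               = outer_dart q v (outer_left D')).

(* In the moves below the base point stays outside of the disc in which the
   diagram is modified. *)

(* RI if [c] is real, VRI if [c] is virtual. *)
Variant move1 (D D' : diagram) : Prop :=
| Move1 (c : nat) (b : bool) (w1 w2 : seq passage) of
    word D = w1 ++ w2
  & word D' = w1 ++ [:: (c, b); (c, ~~ b)] ++ w2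
  & same_kinds (word D) D D'
  & outer_left D' = outer_left D.

(* RII if [a] and [c] are real, VRII if they are virtual.  The first strand
   crosses the second one to one side at [a] and back at [c]; the condition on
   the kinds says that it is over at both, under at both, or that both double
   points are virtual.  The second strand meets [a] and [c] in either order. *)
Variant move2 (D D' : diagram) : Prop :=
| Move2 (a c : nat) (b r : bool) (w1 w2 w3 : seq passage) of
    word D = w1 ++ w2 ++ w3
  & word D' =
      w1 ++ [:: (a, b); (c, ~~ b)] ++ w2 ++
        (if r then [:: (c, b); (a, ~~ b)] else [:: (a, ~~ b); (c, b)]) ++ w3
  & kind D' c = omap negb (kind D' a)
  & same_kinds (word D) D D'
  & outer_left D' = outer_left D.

(* The two ends of an edge, in the direction of the curve. *)
Definition edge : Type := (passage * passage)%type.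

(* Walking along [s] (forwards iff [d]) and turning left leads to [t] (forwards
   iff [e]). *)
Definition corner (s : edge) (d : bool) (t : edge) (e : bool) : Prop :=
  turn (if d then s.2 else s.1) d = (if e then t.1 else t.2, e).

Definition triangular_face (s t u : edge) : Prop :=
  exists d e f, [/\ corner s d t e, corner t e u f & corner u f s d].

Definition is_virtual (k : nat -> option bool) (p : passage) : bool :=
  k p.1 == None.
Definition is_over (k : nat -> option bool) (p : passage) : bool :=
  k p.1 == Some p.2.
Definition is_under (k : nat -> option bool) (p : passage) : bool :=
  k p.1 == Some (~~ p.2).

Definition all_along (P : pred passage) (s : edge) : bool := P s.1 && P s.2.

(* RIII: one strand is over the two others, and one is under the two others. *)
Definition kinds_RIII (k : nat -> option bool) (l : seq edge) : bool :=
  has (all_along (is_over k)) l && has (all_along (is_under k)) l.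

(* VRIII (all three double points are virtual) and VRIV (the third one, off the
   strand which is virtual all along, is real). *)
Definition kinds_VRIII_VRIV (k : nat -> option bool) (l : seq edge) : bool :=
  has (all_along (is_virtual k)) l.

Definition fwd (s : edge) : seq passage := [:: s.1; s.2].
Definition bwd (s : edge) : seq passage := [:: s.2; s.1].

Variant move3 (D D' : diagram) : Prop :=
| Move3 (s t u : edge) (w1 w2 w3 w4 : seq passage) of
    word D = w1 ++ fwd s ++ w2 ++ fwd t ++ w3 ++ fwd u ++ w4
  & word D' = w1 ++ bwd s ++ w2 ++ bwd t ++ w3 ++ bwd u ++ w4
  & (triangular_face s t u \/ triangular_face s u t)
  & kinds_RIII (kind D) [:: s; t; u] || kinds_VRIII_VRIV (kind D) [:: s; t; u]
  & same_kinds (word D) D D'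
  & outer_left D' = outer_left D.

Variant elementary_move (D D' : diagram) : Prop :=
| EIsotopy of planar_isotopy D D'
| EMove1 of move1 D D'
| EMove2 of move2 D D'
| EMove3 of move3 D D'.

Definition equivalent : diagram -> diagram -> Prop :=
  clos_refl_sym_trans diagram elementary_move.

Record virtual_knot : Type := VirtualKnot {
  presents : diagram -> Prop;
  presents_class : exists D, forall D', presents D' <-> equivalent D D'
}.

Definition presents_trivial_knot (D : diagram) : Prop :=
  exists2 O : diagram, word O = [::] & equivalent O D.

Definition crossings (D : diagram) : seq nat :=
  [seq c <- [seq p.1 | p <- word D & p.2] | kind D c != None].

(* [D'] is [D] with [m] real crossings made virtual and [n] others switched. *)
Definition changed (m n : nat) (D D' : diagram) : Prop :=
  [/\ word D' = word D,
      outer_left D' = outer_left D,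
      forall p, p \in word D ->
        kind D' p.1 \in [:: kind D p.1; None; omap negb (kind D p.1)],
      count (fun c => kind D' c == None) (crossings D) = m
    & count (fun c => kind D' c == omap negb (kind D c)) (crossings D) = n].

Definition unknottable (D : diagram) (mn : nat *l nat) : Prop :=
  exists2 D', changed mn.1 mn.2 D D' & presents_trivial_knot D'.

Definition is_minimum (S : nat *l nat -> Prop) (x : nat *l nat) : Prop :=
  S x /\ forall y, S y -> (x <= y)%O.

Definition diagram_unknotting_index (D : diagram) : nat *l nat -> Prop :=
  is_minimum (unknottable D).

Definition unknotting_index (K : virtual_knot) : nat *l nat -> Prop :=
  is_minimum (fun x => exists2 D, presents K D & diagram_unknotting_index D x).

(* Main.v *)
Require Import Defs.
From mathcomp Require Import all_algebra.
From mathcomp Require Import ring zify.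

(** Let [K_n] be the connected sum of a fixed virtual knot, the core below, and
    of [n] trefoils.  Once one particular crossing of the core is virtual, the
    core unravels by moves of types I and II alone, and so does a trefoil with one
    crossing switched.  Hence [K_n] is [(1, n)]-unknottable.  That no diagram of
    [K_n] does better follows from two invariants.

    The first one is the number of Fox colourings in a finite ring [V]: a colour
    for each arc, such that at a crossing the colours [x], [x'] of the two under
    arcs and the colour [y] of the over arc satisfy [x + x' = 2 y]
    ([many_elementary]).  If [x = y] at a crossing, then all the arcs there have
    the same colour and the colouring survives whatever the crossing becomes,
    switched or virtual.  The difference [x - y] takes at most [#|V|] values, so
    at least one colouring in [#|V|] has the same difference, and subtracting one
    of these from the others gives colourings of the changed diagram
    ([changed_bound]).  For [V = 'F_3] the knot [K_n] has at least [3 ^ (n + 2)]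
    colourings, the trivial knot has [3]; therefore [a + b >= n + 1] if a diagram
    of [K_n] is [(a, b)]-unknottable.

    The second one does not see which strand is over.  The index of a real
    crossing is the algebraic number of real crossings met along one of its two
    loops, the loop being chosen by the orientation of the plane; for an odd
    function [f], the sum of [f] over the indices is invariant
    ([flat_index_elementary]), because the two crossings of a move II have
    opposite indices.  Crossing changes preserve it ([flat_index_changed]), but it
    is [2] on [K_n] and [0] on the trivial knot.  Hence [a >= 1], and [a = 1]
    forces [b >= n].

    The diagrams needed for [K_n] and its unknotting are planar: in a
    concatenation of two words the faces on the left of the base edges merge, as
    do those on the right, and all others persist ([face_labelling_cat]), which
    is what Euler's formula requires.  So it is enough to count the faces of a
    few explicit words. *)

Set Implicit Arguments.
Unset Strict Implicit.
Unset Printing Implicit Defensive.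

Import GRing.Theory.

Implicit Types (k : nat -> option bool) (w : seq passage).

(** * Gauss words *)

Lemma mateK : involutive mate.
Proof. by case=> c b; rewrite /mate /= negbK. Qed.

Lemma mate_mem w p : gauss_word w -> (mate p \in w) = (p \in w).
Proof.
case/andP=> _ /allP mw; apply/idP/idP => [/mw|/mw //].
by rewrite mateK.
Qed.

Definition labels w : seq nat := [seq p.1 | p <- w].

Lemma same_label (p q : passage) : p.1 = q.1 -> q = p \/ q = mate p.
Proof.
by case: p => c []; case: q => c' [] /= <-; [left | right | right | left].
Qed.

Lemma label_neq c w (p : passage) : c \notin labels w -> p \in w -> p.1 != c.
Proof. by move=> cw pw; apply: contraNneq cw => <-; apply: map_f. Qed.

Lemma uniq_labels (u v : seq passage) p :
  uniq (u ++ v) -> p \in u -> mate p \in u -> p.1 \notin labels v.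
Proof.
rewrite cat_uniq => /and3P[_ /hasPn disj _] pu mu.
apply/negP=> /mapP[q qv] /same_label[] E; move: (disj q qv); rewrite E ?pu ?mu //.
Qed.

Lemma bigon_mem (a c e : nat) (b r b' : bool) : e \in [:: a; c] ->
  (e, b') \in [:: (a, b); (c, ~~ b)] ++
     (if r then [:: (c, b); (a, ~~ b)] else [:: (a, ~~ b); (c, b)]).
Proof.
by rewrite !inE => /orP[]/eqP->; case: r; case: b; case: b'; rewrite /= !inE !eqxx ?orbT.
Qed.

Lemma gauss_rotate i w : gauss_word w -> gauss_word (rot i w).
Proof.
by case/andP=> U /allP mw; rewrite /gauss_word rot_uniq U; apply/allP=> p;
  rewrite !mem_rot; apply: mw.
Qed.

(** * The triangle of the third move *)

Definition edge_of (e : edge) (p q : passage) : Prop := e = (p, q) \/ e = (q, p).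

Lemma edge_ofC e p q : edge_of e p q -> edge_of e q p.
Proof. by case; [right|left]. Qed.

Lemma all_along_of (P : pred passage) e p q :
  edge_of e p q -> all_along P e = P p && P q.
Proof. by case=> ->; rewrite /all_along //= andbC. Qed.

(** Only the incidences of the triangle are kept here: each strand meets the two
    others, in the order that the triangle dictates.  The directions matter for the
    flat index alone. *)
Lemma triangularP s t u : triangular_face s t u ->
  exists p q r, [/\ edge_of s (mate r) p, edge_of t (mate p) q & edge_of u (mate q) r].
Proof.
case=> d [e [f [[Hp _] [Hq _] [Hr _]]]].
exists (if d then s.2 else s.1), (if e then t.2 else t.1), (if f then u.2 else u.1).
rewrite Hp Hq Hr /edge_of.
by case: s {Hp Hr} => ? ?; case: t {Hq} => ? ?; case: u => ? ?;
  case: d; case: e; case: f; split; auto.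
Qed.

Definition rev_edge (e : edge) : edge := (e.2, e.1).

(** A move of type III is its own inverse: the triangle is turned inside out, with
    all its sides walked the other way. *)
Lemma triangular_rev s t u :
  triangular_face s t u -> triangular_face (rev_edge s) (rev_edge t) (rev_edge u).
Proof.
case=> d [e [f [Hp Hq Hr]]]; exists (~~ d), (~~ e), (~~ f).
move: Hp Hq Hr; rewrite /corner /turn.
case: s => s1 s2; case: t => t1 t2; case: u => u1 u2 /=.
by case: d; case: e; case: f => /= -[-> /eqP h1] [-> /eqP h2] [-> /eqP h3];
 split; congr (_, _); move: h1 h2 h3; case: (_.2); case: (_.2); case: (_.2).
Qed.

Lemma triangle_labels (s t u : edge) p q r :
    edge_of s (mate r) p -> edge_of t (mate p) q -> edge_of u (mate q) r ->
    uniq (fwd s ++ fwd t ++ fwd u) ->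
  [/\ p.1 != q.1, q.1 != r.1 & r.1 != p.1].
Proof.
move=> Hs Ht Hu.
have: perm_eq (fwd s ++ fwd t ++ fwd u) [:: p; mate p; q; mate q; r; mate r].
  apply/permP => a /=; case: Hs Ht Hu => -> [] -> [] -> /=; lia.
move/perm_uniq=> ->.
have neq (a b : passage) : a != b -> mate a != b -> a.1 != b.1.
  move=> ab mab; apply/eqP=> /same_label[] Eb; move: ab mab; rewrite Eb eqxx //.
rewrite /= !inE !negb_or => /and5P[/and5P[_ pq _ pr _] /and4P[mpq _ mpr _] /and3P[_ qr
  _] /andP[mqr _] _].
split; try exact: neq; rewrite eq_sym; exact: neq.
Qed.

(** The words before and after a third move are [weave fwd] and [weave bwd] of the
    same data; keeping the three sides in one list lets statements range over them
    without distinguishing cases. *)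
Definition weave (f : edge -> seq passage) (l : seq edge) (w1 w2 w3 w4 : seq passage) :=
  if l is [:: s; t; u] then w1 ++ f s ++ w2 ++ f t ++ w3 ++ f u ++ w4 else [::].

Lemma weave_perm (s t u : edge) w1 w2 w3 w4 :
  perm_eq (weave fwd [:: s; t; u] w1 w2 w3 w4)
          ((fwd s ++ fwd t ++ fwd u) ++ w1 ++ w2 ++ w3 ++ w4).
Proof. by apply/permP=> a; rewrite /weave /fwd /bwd !count_cat /=; lia. Qed.

Lemma weave_bwd_perm (s t u : edge) w1 w2 w3 w4 :
  perm_eq (weave fwd [:: s; t; u] w1 w2 w3 w4)
          (weave bwd [:: s; t; u] w1 w2 w3 w4).
Proof. by apply/permP=> a; rewrite /weave /fwd /bwd !count_cat /=; lia. Qed.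

Lemma weave_rev (s t u : edge) w1 w2 w3 w4 :
  weave fwd [:: rev_edge s; rev_edge t; rev_edge u] w1 w2 w3 w4 =
  weave bwd [:: s; t; u] w1 w2 w3 w4.
Proof. by []. Qed.

Definition kinds3 k (l : seq edge) := kinds_RIII k l || kinds_VRIII_VRIV k l.

Lemma kinds3_rev k (s t u : edge) :
  kinds3 k [:: rev_edge s; rev_edge t; rev_edge u] = kinds3 k [:: s; t; u].
Proof.
by rewrite /kinds3 /kinds_RIII /kinds_VRIII_VRIV /has /all_along /= ![_ _.2 && _]andbC.
Qed.

(** A strand that is virtual all along shares a crossing with each of the two
    others. *)
Lemma virtual_edges k (s t u : edge) :
    triangular_face s t u \/ triangular_face s u t ->
    kinds_VRIII_VRIV k [:: s; t; u] ->
  {in [:: s; t; u], forall e, is_virtual k e.1 || is_virtual k e.2}.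
Proof.
wlog: t u / triangular_face s t u => [IH [] tri kin|/triangularP[p [q [r [Hs Ht Hu]]]] _].
- by apply: IH => //; left.
- have h := IH u t tri (or_introl tri).
  move=> e eL; apply: h; last by move: eL; rewrite !inE [(e == u) || _]orbC.
  by move: kin; rewrite /kinds_VRIII_VRIV /=; do 3!case: (all_along _ _).
have virt e p' q' : edge_of e p' q' ->
    is_virtual k e.1 || is_virtual k e.2 = is_virtual k p' || is_virtual k q'.
  by case=> -> //=; rewrite orbC.
rewrite /kinds_VRIII_VRIV /= (all_along_of _ Hs) (all_along_of _ Ht) (all_along_of _ Hu).
move=> vir e; rewrite !inE => /or3P[]/eqP->;
  rewrite (virt _ _ _ Hs, virt _ _ _ Ht, virt _ _ _ Hu).
all: by move: vir; rewrite /is_virtual /=; do 3!case: (_ == None).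
Qed.

Lemma is_over_mate k p : is_over k (mate p) = is_under k p.
Proof. by []. Qed.

Lemma is_under_mate k p : is_under k (mate p) = is_over k p.
Proof. by rewrite /is_under /= negbK. Qed.

Lemma over_under k p : is_over k p -> is_under k p -> False.
Proof. by rewrite /is_over /is_under => /eqP->; case: p.2. Qed.

Lemma under_not_over k p : is_under k p -> is_over k p = false.
Proof. by move=> up; apply/negP=> /over_under/(_ up). Qed.

(** [A] and [B] are the passages of the top strand over the middle and the bottom
    one, and [C] that of the middle strand over the bottom one. *)
Definition layered k (l : seq edge) A B C : Prop :=
  [/\ is_over k A, is_over k B, is_over k C, A.1 != C.1 & B.1 != C.1] /\
  exists o m u, [/\ l =i [:: o; m; u], edge_of o A B,
                    edge_of m (mate A) C & edge_of u (mate B) (mate C)].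

Lemma layered_perm k (l l' : seq edge) A B C :
  l =i l' -> layered k l A B C -> layered k l' A B C.
Proof.
move=> ll' [ov [o [m [u [El oE mE uE]]]]]; split=> //.
by exists o, m, u; split=> // e; rewrite -ll'.
Qed.

(** The three passages around the triangle can be permuted cyclically, so the top
    strand may be taken to be the first one. *)
Lemma layered_over_first k (s t u : edge) p q r :
    edge_of s (mate r) p -> edge_of t (mate p) q -> edge_of u (mate q) r ->
    [/\ p.1 != q.1, q.1 != r.1 & r.1 != p.1] ->
    all_along (is_over k) s -> has (all_along (is_under k)) [:: t; u] ->
  exists A B C, layered k [:: s; t; u] A B C.
Proof.
move=> Hs Ht Hu [pq qr rp].
rewrite (all_along_of _ Hs) /= orbF (all_along_of _ Ht) (all_along_of _ Hu).
rewrite is_over_mate !is_under_mate => /andP[ur op] /orP[/andP[_ uq]|/andP[oq _]].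
  exists (mate r), p, (mate q); split; first by split; rewrite // eq_sym.
  exists s, u, t; rewrite !mateK; split=> // [e|]; last exact: edge_ofC.
  by rewrite !inE [(e == t) || _]orbC.
exists p, (mate r), q; split; first by split; rewrite // eq_sym.
exists s, t, u; rewrite mateK; split=> //; exact: edge_ofC.
Qed.

Lemma layeredP k (s t u : edge) :
    uniq (fwd s ++ fwd t ++ fwd u) ->
    triangular_face s t u \/ triangular_face s u t ->
    kinds_RIII k [:: s; t; u] ->
  exists A B C, layered k [:: s; t; u] A B C.
Proof.
wlog: t u / triangular_face s t u => [IH U [] tri kin|].
- by apply: IH => //; left.
- have [||A [B [C L]]] := IH _ _ tri _ (or_introl tri).
  + rewrite -(perm_uniq (_ : perm_eq (fwd s ++ fwd t ++ fwd u) _)) //.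
    by rewrite perm_cat2l perm_catC.
  + by move: kin; rewrite /kinds_RIII /=; do 6!case: (all_along _ _).
  exists A, B, C; apply: layered_perm L => e.
  by rewrite !inE [(e == u) || _]orbC.
case/triangularP=> p [q [r [Hs Ht Hu]]] U _ /andP[].
have [pq qr rp] := triangle_labels Hs Ht Hu U.
have noboth e : all_along (is_over k) e -> all_along (is_under k) e -> False.
  by case/andP=> h _ /andP[h' _]; apply: over_under h h'.
(* The top strand is found first; the bottom one is another side. *)
rewrite {1}/has => /or4P[ov|ov|ov|//] un.
- apply: (layered_over_first Hs Ht Hu) => //.
  by move: un; rewrite /= => /or4P[/(noboth _ ov)[]|->|->|]; rewrite ?orbT.
- have [||A [B [C L]]] := layered_over_first Ht Hu Hs _ ov => //.
    by move: un; rewrite /= => /or4P[->|/(noboth _ ov)[]|->|]; rewrite ?orbT.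
  exists A, B, C; apply: layered_perm L => e.
  by rewrite !inE orbA orbC.
have [||A [B [C L]]] := layered_over_first Hu Hs Ht _ ov => //.
  by move: un; rewrite /= => /or4P[->|->|/(noboth _ ov)[]|]; rewrite ?orbT.
exists A, B, C; apply: layered_perm L => e.
by rewrite !inE orbC -orbA.
Qed.

(** * Fox colourings *)

Section Colouring.

Local Open Scope ring_scope.

Variable V : finComNzRingType.
Implicit Types (y : nat -> V) (s : V).

(** The colour of an arc after the passage [p], if it was [s] before.  A colouring
    records the colour [y c] of the over arc at each real crossing [c] rather than
    the colour of every arc: this is what the moves change the least. *)
Definition pass k y s (p : passage) : V :=
  if is_under k p then y p.1 + y p.1 - s else s.

Definition walk k y s w : V := foldl (pass k y) s w.

Fixpoint over_ok k y s w : bool :=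
  if w is p :: w' then
    (is_over k p ==> (s == y p.1)) && over_ok k y (pass k y s p) w'
  else true.

(** A colouring is the pair of the colours of the over arcs and of the colour of
    the base edge; the latter matters when a closed curve has no real crossing. *)
Definition coloured k w (e : (nat -> V) * V) : bool :=
  over_ok k e.1 e.2 w && (walk k e.1 e.2 w == e.2).

(** The value of [y] at a virtual crossing is not the colour of an arc. *)
Definition same_colours k w (e e' : (nat -> V) * V) : Prop :=
  e.2 = e'.2 /\ forall p, p \in w -> k p.1 != None -> e.1 p.1 = e'.1 p.1.

(** There are at least [#|T|] colourings.  Colourings being functions on all of
    [nat], they are counted by families that the word itself can tell apart. *)
Definition many_colourings (T : finType) k w : Prop :=
  exists phi : T -> (nat -> V) * V,
    (forall i, coloured k w (phi i)) /\
    (forall i j, same_colours k w (phi i) (phi j) -> i = j).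

Lemma walk_cat k y s w1 w2 :
  walk k y s (w1 ++ w2) = walk k y (walk k y s w1) w2.
Proof. exact: foldl_cat. Qed.

Lemma over_ok_cat k y s w1 w2 :
  over_ok k y s (w1 ++ w2) = over_ok k y s w1 && over_ok k y (walk k y s w1) w2.
Proof.
by elim: w1 s => //= p w1 IH s; rewrite IH andbA.
Qed.

Lemma eq_pass k k' y y' s p :
    k p.1 = k' p.1 -> (k p.1 != None -> y p.1 = y' p.1) ->
  pass k y s p = pass k' y' s p.
Proof.
rewrite /pass /is_under => <-; case: (k p.1) => // o /(_ isT) -> //.
Qed.

Lemma eq_walk k k' y y' s w :
    (forall p, p \in w -> k p.1 = k' p.1) ->
    (forall p, p \in w -> k p.1 != None -> y p.1 = y' p.1) ->
  walk k y s w = walk k' y' s w.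
Proof.
elim: w s => //= p w IH s Ek Ey.
rewrite (@eq_pass k k' y y' s p); [|exact/Ek/mem_head|exact/Ey/mem_head].
by apply: IH => q qw; [apply: Ek | apply: Ey]; rewrite inE qw orbT.
Qed.

Lemma eq_over_ok k k' y y' s w :
    (forall p, p \in w -> k p.1 = k' p.1) ->
    (forall p, p \in w -> k p.1 != None -> y p.1 = y' p.1) ->
  over_ok k y s w = over_ok k' y' s w.
Proof.
elim: w s => //= p w IH s Ek Ey.
rewrite (@eq_pass k k' y y' s p); [|exact/Ek/mem_head|exact/Ey/mem_head].
congr (_ && _); last first.
  by apply: IH => q qw; [apply: Ek | apply: Ey]; rewrite inE qw orbT.
rewrite /is_over -(Ek p (mem_head _ _)).
have := Ey p (mem_head _ _).
by case: (k p.1) => //= o /(_ isT) ->.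
Qed.

Lemma eq_coloured k k' w e :
  (forall p, p \in w -> k p.1 = k' p.1) -> coloured k w e = coloured k' w e.
Proof.
move=> Ek; rewrite /coloured.
by rewrite (@eq_over_ok k k' e.1 e.1) // (@eq_walk k k' e.1 e.1).
Qed.

(** All invariance proofs below go through such a map [F] of colourings, which only
    has to be injective up to [same_colours]. *)
Lemma many_transfer k k' w w' (F : (nat -> V) * V -> (nat -> V) * V) :
    (forall e, coloured k w e -> coloured k' w' (F e)) ->
    (forall e e', coloured k w e -> coloured k w e' ->
      same_colours k' w' (F e) (F e') -> same_colours k w e e') ->
  forall T, many_colourings T k w -> many_colourings T k' w'.
Proof.
move=> Fcol Finj T [phi [col inj]]; exists (F \o phi); split=> [i|i j Eij].
  exact: Fcol.
exact/inj/Finj.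
Qed.

Lemma many_eq k k' w :
    (forall p, p \in w -> k p.1 = k' p.1) ->
  forall T, many_colourings T k w -> many_colourings T k' w.
Proof.
move=> Ek; apply: (@many_transfer _ _ _ _ id) => [e|e e' _ _ [Es Ey]].
  by rewrite (eq_coloured _ Ek).
by split=> // p pw; rewrite Ek //; apply: Ey.
Qed.

Lemma many_same_kinds T k k' w : (forall p, p \in w -> k p.1 = k' p.1) ->
  many_colourings T k w <-> many_colourings T k' w.
Proof. by move=> E; split; apply: many_eq => // p /E. Qed.

Definition recolour y c v : nat -> V := fun d => if d == c then v else y d.

Lemma recolour_other y c v d : d != c -> recolour y c v d = y d.
Proof. by rewrite /recolour => /negPf->. Qed.

Lemma recolour_same y c v : recolour y c v c = v.
Proof. by rewrite /recolour eqxx. Qed.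

Lemma walk_recolour k y c v s w :
  c \notin labels w -> walk k (recolour y c v) s w = walk k y s w.
Proof.
move=> cw; apply: eq_walk => // p pw _.
by rewrite recolour_other // (label_neq cw pw).
Qed.

Lemma over_ok_recolour k y c v s w :
  c \notin labels w -> over_ok k (recolour y c v) s w = over_ok k y s w.
Proof.
move=> cw; apply: eq_over_ok => // p pw _.
by rewrite recolour_other // (label_neq cw pw).
Qed.

(** * Colourings and the moves *)

Lemma double_sub_eq (u v : V) : (u + u - v == u) = (v == u).
Proof. by rewrite subr_eq (inj_eq (addrI u)) eq_sym. Qed.

(** In a kink the over arc follows or precedes the under arc, so all arcs have the
    same colour. *)
Lemma kink_ok k y s c b :
  over_ok k y s [:: (c, b); (c, ~~ b)] = (k c != None) ==> (s == y c).
Proof.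
rewrite /= /pass /is_over /is_under /=.
by case: (k c) => [[]|]; case: b => //=; rewrite ?andbT ?double_sub_eq.
Qed.

Lemma kink_walk k y s c b : over_ok k y s [:: (c, b); (c, ~~ b)] ->
  walk k y s [:: (c, b); (c, ~~ b)] = s.
Proof.
rewrite kink_ok /walk /pass /is_over /is_under /=.
case: (k c) => [o|]; last by [].
by move=> /= /eqP->; case: o; case: b => /=; rewrite addrK.
Qed.

(** The colour of the new crossing is forced: it is the colour of the strand on
    which the kink is made. *)
Lemma many_kink T k c b w1 w2 :
    c \notin labels w1 -> c \notin labels w2 ->
  many_colourings T k (w1 ++ w2) <->
  many_colourings T k (w1 ++ [:: (c, b); (c, ~~ b)] ++ w2).
Proof.
move=> cw1 cw2; set X := [:: (c, b); (c, ~~ b)].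
have XO y s : over_ok k y s X = (k c != None) ==> (s == y c) by exact: kink_ok.
have XW y s : over_ok k y s X -> walk k y s X = s by exact: kink_walk.
have Xc p : p \in X -> p.1 = c.
  by rewrite !inE => /orP[] /eqP->.
clearbody X; split; last first.
  apply: (@many_transfer _ _ _ _ id) => [[y s]|[y s] [y' s']].
    rewrite /coloured /= !(over_ok_cat, walk_cat).
    by case/andP=> /and3P[-> /XW -> ->].
  rewrite /coloured /= !(over_ok_cat, walk_cat) !XO.
  case/andP=> /and3P[_ yc _] _ /andP[/and3P[_ yc' _] _] [/= Es Ey];
    rewrite -{}Es in yc' *.
  split=> // p; rewrite !mem_cat /= => pw kp.
  case: (eqVneq p.1 c) => [Epc|pc]; last first.
    have /negPf pX : p \notin X by apply: contraNN pc => /Xc->.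
    by apply: Ey => //; move: pw; rewrite pX mem_cat.
  move: yc yc'; rewrite -!Epc kp /= => /eqP <- /eqP <-.
  apply: eq_walk => // q qw kq; apply: Ey => //.
  by rewrite mem_cat qw.
pose F (e : (nat -> V) * V) := (recolour e.1 c (walk k e.1 e.2 w1), e.2).
apply: (@many_transfer _ _ _ _ F) => [[y s]|[y s] [y' s'] _ _].
  rewrite /coloured /F /= !(over_ok_cat, walk_cat).
  rewrite !(walk_recolour _ _ _ _ cw1, over_ok_recolour _ _ _ _ cw1).
  set st := walk k y s w1; set y1 := recolour _ _ _.
  have ok : over_ok k y1 st X by rewrite XO /y1 recolour_same eqxx implybT.
  rewrite (XW _ _ ok) ok /y1.
  by rewrite !(walk_recolour _ _ _ _ cw2, over_ok_recolour _ _ _ _ cw2).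
case=> /= Es Ey; split=> // p pw kp.
have pc : p.1 != c.
  by move: pw; rewrite mem_cat => /orP[]; apply: label_neq.
have := Ey p; rewrite !recolour_other // !mem_cat; apply => //.
by move: pw; rewrite mem_cat => /orP[] ->; rewrite ?orbT.
Qed.

(** [X] is the part of a clasp that runs over the other strand twice. *)
Definition over_pair k X a c := forall y s,
  walk k y s X = s /\ over_ok k y s X = (s == y a) && (s == y c).

(** Passing twice under the same colour [v] maps [s] to [2 v - (2 v - s) = s]. *)
Definition under_pair k X a c := forall y s,
  over_ok k y s X /\ (y a = y c -> walk k y s X = s).

(** The move of type II, whichever of the two strands is over: both new crossings
    receive the colour of the over strand.  The order of [a] and [c] on the under
    strand does not matter, hence neither does the direction in which it runs. *)
Lemma many_overlap T k a c X Y w1 w2 w3 :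
    over_pair k X a c /\ under_pair k Y a c \/
    under_pair k X a c /\ over_pair k Y a c ->
    {subset labels (X ++ Y) <= [:: a; c]} ->
    {in labels (w1 ++ w2 ++ w3), forall d, d \notin [:: a; c]} ->
  many_colourings T k (w1 ++ w2 ++ w3) <->
  many_colourings T k (w1 ++ X ++ w2 ++ Y ++ w3).
Proof.
move=> XY labXY fresh.
have sub : {subset w1 ++ w2 ++ w3 <= w1 ++ X ++ w2 ++ Y ++ w3}.
  by move=> p; rewrite !mem_cat; do 3!case: (p \in _); rewrite ?orbT.
have freshP p : p \in w1 ++ w2 ++ w3 -> (p.1 != a) && (p.1 != c).
  by move=> /(map_f fst)/fresh; rewrite !inE negb_or.
have fresh1 d : d \in [:: a; c] -> d \notin labels w1.
  move=> dac; apply/negP=> dw; have := fresh d.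
  by rewrite /labels map_cat mem_cat dw dac; move/(_ isT).
have fresh2 d : d \in [:: a; c] -> d \notin labels w2.
  move=> dac; apply/negP=> dw; have := fresh d.
  by rewrite /labels !map_cat !mem_cat dw dac orbT; move/(_ isT).
have fresh3 d : d \in [:: a; c] -> d \notin labels w3.
  move=> dac; apply/negP=> dw; have := fresh d.
  by rewrite /labels !map_cat !mem_cat dw dac !orbT; move/(_ isT).
have ina : a \in [:: a; c] by rewrite mem_head.
have inc : c \in [:: a; c] by rewrite !inE eqxx orbT.
have W1 k' y u v s : walk k' (recolour (recolour y a u) c v) s w1 = walk k' y s w1.
  by rewrite !walk_recolour ?fresh1.
have O1 k' y u v s :
    over_ok k' (recolour (recolour y a u) c v) s w1 = over_ok k' y s w1.
  by rewrite !over_ok_recolour ?fresh1.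
have W2 k' y u v s : walk k' (recolour (recolour y a u) c v) s w2 = walk k' y s w2.
  by rewrite !walk_recolour ?fresh2.
have O2 k' y u v s :
    over_ok k' (recolour (recolour y a u) c v) s w2 = over_ok k' y s w2.
  by rewrite !over_ok_recolour ?fresh2.
have W3 k' y u v s : walk k' (recolour (recolour y a u) c v) s w3 = walk k' y s w3.
  by rewrite !walk_recolour ?fresh3.
have O3 k' y u v s :
    over_ok k' (recolour (recolour y a u) c v) s w3 = over_ok k' y s w3.
  by rewrite !over_ok_recolour ?fresh3.
have Fsame y y' v v' s s' :
    same_colours k (w1 ++ X ++ w2 ++ Y ++ w3)
      (recolour (recolour y a v) c v, s) (recolour (recolour y' a v') c v', s') ->
    same_colours k (w1 ++ w2 ++ w3) (y, s) (y', s').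
  case=> /= Es Ey; split=> // p pw kp; case/andP: (freshP _ pw) => pa pc.
  by have := Ey p (sub _ pw) kp; rewrite !recolour_other.
have Dsame y y' s :
    same_colours k (w1 ++ w2 ++ w3) (y, s) (y', s) ->
    y a = y' a -> y c = y' c ->
    same_colours k (w1 ++ X ++ w2 ++ Y ++ w3) (y, s) (y', s).
  case=> _ /= Ey Ea Ec; split=> // p; rewrite !mem_cat => pw kp /=.
  have [|pac] := boolP (p.1 \in [:: a; c]); first by rewrite !inE => /orP[]/eqP->.
  have pXY : p \notin X ++ Y by apply: contra pac => /(map_f fst)/labXY.
  move: pXY; rewrite mem_cat negb_or => /andP[/negPf pX /negPf pY].
  by apply: Ey => //; move: pw; rewrite pX pY !mem_cat.
case: XY => -[HX HY]; split.
- apply: (@many_transfer _ _ _ _ (fun e => let v := walk k e.1 e.2 w1 in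
    (recolour (recolour e.1 a v) c v, e.2))) => [[y s]|[y s] [y' s'] _ _]; last first.
    exact: Fsame.
  rewrite /coloured /= !(over_ok_cat, walk_cat).
  rewrite !(W1, O1).
  set st := walk k y s w1; set y1 := recolour _ _ _.
  have y1a : y1 a = st by rewrite /y1 /recolour eqxx; case: eqP.
  have y1c : y1 c = st by rewrite /y1 /recolour eqxx.
  have [-> ->] := HX y1 st; rewrite y1a y1c eqxx /=.
  rewrite !(W2, O2).
  have [-> ->] := HY y1 (walk k y st w2); last by rewrite y1a y1c.
  by rewrite !(W3, O3).
- apply: (@many_transfer _ _ _ _ id) => [[y s]|[y s] [y' s']];
    rewrite /coloured /= !(over_ok_cat, walk_cat).
    set st := walk k y s w1; have [-> ->] := HX y st.
    case/andP=> /and5P[-> /andP[/eqP Ea /eqP Ec] ok2 okY ok3].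
    have [_ ->] := HY y (walk k y st w2); last by rewrite -Ea -Ec.
    by move=> ->; rewrite ok2 /=; move: ok3; have [_ ->] := HY y (walk k y st w2);
      rewrite -?Ea -?Ec // => ->.
  set st := walk k y s w1; set st' := walk k y' s' w1.
  have [_ ->] := HX y st; have [_ ->] := HX y' st'.
  case/andP=> /and3P[_ /andP[/eqP Ea /eqP Ec] _] _.
  case/andP=> /and3P[_ /andP[/eqP Ea' /eqP Ec'] _] _ S.
  have Est : st = st'.
    case: (S) => /= Es Ey; rewrite /st /st' -Es.
    by apply: eq_walk => // q qw kq; apply: Ey => //; rewrite mem_cat qw.
  case: (S) => /= Es _; rewrite -Es in S *.
  by apply: Dsame; rewrite // -?Ea -?Ea' -?Ec -?Ec'.
- apply: (@many_transfer _ _ _ _ (fun e => let v := walk k e.1 e.2 (w1 ++ w2) in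
    (recolour (recolour e.1 a v) c v, e.2))) => [[y s]|[y s] [y' s'] _ _]; last first.
    exact: Fsame.
  rewrite /coloured /= !(over_ok_cat, walk_cat).
  rewrite !(W1, O1).
  set st := walk k y s w1; set st2 := walk k y st w2; set y1 := recolour _ _ _.
  have y1a : y1 a = st2 by rewrite /y1 /recolour eqxx; case: eqP.
  have y1c : y1 c = st2 by rewrite /y1 /recolour eqxx.
  have [-> ->] := HX y1 st; last by rewrite y1a y1c.
  rewrite !(W2, O2).
  have [-> ->] := HY y1 st2; rewrite y1a y1c eqxx /=.
  by rewrite !(W3, O3).
- apply: (@many_transfer _ _ _ _ id) => [[y s]|[y s] [y' s']];
    rewrite /coloured /= !(over_ok_cat, walk_cat).
    set st := walk k y s w1; have [-> EX] := HX y st.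
    set st2 := walk k y _ w2; have [-> ->] := HY y st2.
    case/andP=> /and5P[-> _ ok2 /andP[/eqP Ea /eqP Ec]].
    by rewrite /st2 EX -?Ea -?Ec // in ok2 * => ->; rewrite ok2.
  set st := walk k y s w1; set st' := walk k y' s' w1.
  have [_ EX] := HX y st; have [_ EX'] := HX y' st'.
  set st2 := walk k y _ w2; set st2' := walk k y' _ w2.
  have [_ ->] := HY y st2; have [_ ->] := HY y' st2'.
  case/andP=> /and5P[_ _ _ /andP[/eqP Ea /eqP Ec] _] _.
  case/andP=> /and5P[_ _ _ /andP[/eqP Ea' /eqP Ec'] _] _ S.
  (* Both colourings agree on the smaller word, hence so does the colour of the
     over strand, which is that of the new crossings. *)
  have Est : st2 = st2'.
    rewrite /st2 /st2' EX -?Ea -?Ec // EX' -?Ea' -?Ec' // /st /st'.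
    case: (S) => /= <- Ey; rewrite -!walk_cat.
    apply: eq_walk => // q qw kq; apply: Ey => //.
    by move: qw; rewrite !mem_cat => /orP[] ->; rewrite ?orbT.
  case: (S) => /= Es _; rewrite -Es in S *.
  by apply: Dsame; rewrite // -?Ea -?Ea' -?Ec -?Ec'.
Qed.

Lemma walk_virtual k y s X : all (is_virtual k) X -> walk k y s X = s.
Proof.
elim: X => //= p X IH /andP[/eqP kp /IH].
by rewrite /pass /is_under kp.
Qed.

Lemma over_ok_virtual k y s X : all (is_virtual k) X -> over_ok k y s X.
Proof.
elim: X => //= p X IH /andP[/eqP kp /IH].
by rewrite /pass /is_over /is_under kp.
Qed.

Lemma many_virtual T k X Y w1 w2 w3 :
    all (is_virtual k) X -> all (is_virtual k) Y ->
  many_colourings T k (w1 ++ w2 ++ w3) <->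
  many_colourings T k (w1 ++ X ++ w2 ++ Y ++ w3).
Proof.
move=> vX vY.
have Ecol (e : (nat -> V) * V) : coloured k (w1 ++ X ++ w2 ++ Y ++ w3) e = coloured k
  (w1 ++ w2 ++ w3) e.
  rewrite /coloured !(over_ok_cat, walk_cat).
  rewrite !(over_ok_virtual _ _ vX, over_ok_virtual _ _ vY).
  by rewrite !(walk_virtual _ _ vX, walk_virtual _ _ vY).
have Esame (e e' : (nat -> V) * V) : same_colours k (w1 ++ X ++ w2 ++ Y ++ w3) e e' <->
    same_colours k (w1 ++ w2 ++ w3) e e'.
  split=> -[Es Ey]; split=> // p pw kp; apply: Ey => //.
    by move: pw; rewrite !mem_cat; do 3!case: (p \in _); rewrite ?orbT.
  have [/negPf pX /negPf pY] : p \notin X /\ p \notin Y.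
    by split; apply/negP; [move/(allP vX)|move/(allP vY)]; rewrite /is_virtual (negPf kp).
  by move: pw; rewrite !mem_cat pX pY.
split; apply: (@many_transfer _ _ _ _ id) => [e|e e' _ _ /Esame //].
  by rewrite Ecol.
by rewrite Ecol.
Qed.

Lemma many_move2 T k a c b r w1 w2 w3 :
    k c = omap negb (k a) ->
    {in labels (w1 ++ w2 ++ w3), forall d, d \notin [:: a; c]} ->
  many_colourings T k (w1 ++ w2 ++ w3) <->
  many_colourings T k (w1 ++ [:: (a, b); (c, ~~ b)] ++ w2 ++
     (if r then [:: (c, b); (a, ~~ b)] else [:: (a, ~~ b); (c, b)]) ++ w3).
Proof.
move=> kc fresh; case ka: (k a) kc => [o|]; rewrite [omap _ _]/= => kc; last first.
  by apply: many_virtual; case: r; rewrite /= /is_virtual /= ka kc.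
apply: (@many_overlap T k a c) => //; last first.
  by move=> d; case: r; rewrite !inE => /or4P[] /eqP->; rewrite eqxx ?orbT.
have [eob|nob] := eqVneq o b; [left; move: eob | right; move: nob] => eob;
  split => y s; case: r; rewrite /walk /= /pass /is_over /is_under /= ka kc.
all: case: o eob {ka kc fresh}; case: b => //= _.
all: rewrite ?andbT; split=> //; do ?[exact: andbC | move=> ->; ring].
Qed.

Lemma pass_over k y s p : is_over k p -> pass k y s p = s.
Proof.
by rewrite /pass; case: ifP => // up op; case: (over_under op up).
Qed.

Lemma pass_under k y s p : is_under k p -> pass k y s p = y p.1 + y p.1 - s.
Proof. by rewrite /pass => ->. Qed.

(** The effect of a third move on one side of the triangle.  The only over arc that
    is replaced is the short piece of the middle strand between the other two
    crossings.  It lies on the other side of the top strand after the move, so its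
    colour is reflected in that of the top strand, [y A = y B]. *)
Lemma layered_edge k (l : seq edge) A B C y s e :
    layered k l A B C -> y A.1 = y B.1 -> e \in l ->
    over_ok k y s (fwd e) ->
  let y' := recolour y C.1 (y A.1 + y A.1 - y C.1) in
  over_ok k y' s (bwd e) /\ walk k y' s (bwd e) = walk k y s (fwd e).
Proof.
move=> [[oA oB oC AC BC] [o [m [u [El oE mE uE]]]]] yAB.
have edges : e \in l ->
    [\/ edge_of e A B, edge_of e (mate A) C | edge_of e (mate B) (mate C)].
  by rewrite El !inE => /or3P[]/eqP->; [exact: Or31 | exact: Or32 | exact: Or33].
move/edges=> {}edges.
have uA : is_under k (mate A) by rewrite is_under_mate.
have uB : is_under k (mate B) by rewrite is_under_mate.
have uC : is_under k (mate C) by rewrite is_under_mate.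
have y'A v : recolour y C.1 v A.1 = y A.1 by rewrite recolour_other.
have y'B v : recolour y C.1 v B.1 = y B.1 by rewrite recolour_other.
have y'C v : recolour y C.1 v C.1 = v by rewrite recolour_same.
case: edges => -[] -> /=;
   rewrite /walk /= ?oA ?oB ?oC ?(under_not_over uA) ?(under_not_over uB)
     ?(under_not_over uC) /=;
   rewrite ?(pass_over _ _ oA) ?(pass_over _ _ oB) ?(pass_over _ _ oC);
   rewrite ?(pass_under _ _ uA) ?(pass_under _ _ uB) ?(pass_under _ _ uC) /= ?y'A ?y'B
     ?y'C ?yAB ?andbT /=.
- by split.
- by split.
- by move=> /eqP <-; split=> //; apply/eqP; ring.
- by move=> /eqP ->.
- by split=> //; ring.
- by split=> //; ring.
Qed.

Lemma coloured_weave k y y' s0 (s t u : edge) w1 w2 w3 w4 :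
    (forall e st, e \in [:: s; t; u] -> over_ok k y st (fwd e) ->
      over_ok k y' st (bwd e) /\ walk k y' st (bwd e) = walk k y st (fwd e)) ->
    (forall p, p \in w1 ++ w2 ++ w3 ++ w4 -> k p.1 != None -> y p.1 = y' p.1) ->
  coloured k (weave fwd [:: s; t; u] w1 w2 w3 w4) (y, s0) ->
  coloured k (weave bwd [:: s; t; u] w1 w2 w3 w4) (y', s0).
Proof.
move=> edges Ey; rewrite /coloured /weave !(over_ok_cat, walk_cat) /fst /snd.
have piece w st : {subset w <= w1 ++ w2 ++ w3 ++ w4} ->
    over_ok k y st w = over_ok k y' st w /\ walk k y st w = walk k y' st w.
  move=> sub; have Eyw p : p \in w -> k p.1 != None -> y p.1 = y' p.1.
    by move/sub; apply: Ey.
  by split; [apply: eq_over_ok | apply: eq_walk].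
have P1 st : over_ok k y st w1 = over_ok k y' st w1 /\ walk k y st w1 = walk k y' st w1.
  by apply: piece => p; rewrite !mem_cat => ->.
have P2 st : over_ok k y st w2 = over_ok k y' st w2 /\ walk k y st w2 = walk k y' st w2.
  by apply: piece => p; rewrite !mem_cat => ->; rewrite ?orbT.
have P3 st : over_ok k y st w3 = over_ok k y' st w3 /\ walk k y st w3 = walk k y' st w3.
  by apply: piece => p; rewrite !mem_cat => ->; rewrite ?orbT.
have P4 st : over_ok k y st w4 = over_ok k y' st w4 /\ walk k y st w4 = walk k y' st w4.
  by apply: piece => p; rewrite !mem_cat => ->; rewrite ?orbT.
have Es st : over_ok k y st (fwd s) -> over_ok k y' st (bwd s) /\
    walk k y' st (bwd s) = walk k y st (fwd s).
  by apply: edges; rewrite !inE eqxx.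
have Et st : over_ok k y st (fwd t) -> over_ok k y' st (bwd t) /\
    walk k y' st (bwd t) = walk k y st (fwd t).
  by apply: edges; rewrite !inE eqxx ?orbT.
have Eu st : over_ok k y st (fwd u) -> over_ok k y' st (bwd u) /\
    walk k y' st (bwd u) = walk k y st (fwd u).
  by apply: edges; rewrite !inE eqxx ?orbT.
case/andP=> /and5P[ok1 /Es[oks Ws] ok2 /Et[okt Wt] /and3P[ok3 /Eu[oku Wu] ok4]] Ew.
have [E1 F1] := P1 s0; rewrite E1 F1 in ok1 oks Ws ok2 okt Wt ok3 oku Wu ok4 Ew.
rewrite ok1 oks Ws.
set s2 := walk k y _ (fwd s) in ok2 okt Wt ok3 oku Wu ok4 Ew *.
have [E2 F2] := P2 s2; rewrite E2 F2 in ok2 okt Wt ok3 oku Wu ok4 Ew.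
rewrite ok2 okt Wt.
set s3 := walk k y _ (fwd t) in ok3 oku Wu ok4 Ew *.
have [E3 F3] := P3 s3; rewrite E3 F3 in ok3 oku Wu ok4 Ew.
rewrite ok3 oku Wu.
set s4 := walk k y _ (fwd u) in ok4 Ew *.
by have [E4 F4] := P4 s4; rewrite E4 F4 in ok4 Ew; rewrite ok4 Ew.
Qed.

Lemma over_ok_weave k y s0 (e s t u : edge) w1 w2 w3 w4 :
    over_ok k y s0 (weave fwd [:: s; t; u] w1 w2 w3 w4) -> e \in [:: s; t; u] ->
  exists st, over_ok k y st (fwd e).
Proof.
rewrite /weave !over_ok_cat => /and5P[_ oks _ okt /and3P[_ oku _]].
by rewrite !inE => /or3P[]/eqP->; eauto.
Qed.

(** The reflection of [layered_edge] is injective because the colour of the top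
    strand can still be read off after the move. *)
Lemma many_layered T k (s t u : edge) A B C w1 w2 w3 w4 :
    gauss_word (weave fwd [:: s; t; u] w1 w2 w3 w4) ->
    layered k [:: s; t; u] A B C ->
  many_colourings T k (weave fwd [:: s; t; u] w1 w2 w3 w4) ->
  many_colourings T k (weave bwd [:: s; t; u] w1 w2 w3 w4).
Proof.
move=> G L.
have [[oA oB oC AC BC] [o [m [b [El oAB mAC uBC]]]]] := L.
have ol : o \in [:: s; t; u] by rewrite El mem_head.
pose F (e : (nat -> V) * V) := (recolour e.1 C.1 (e.1 A.1 + e.1 A.1 - e.1 C.1), e.2).
have yAB y s0 : over_ok k y s0 (weave fwd [:: s; t; u] w1 w2 w3 w4) -> y A.1 = y B.1.
  case/over_ok_weave/(_ ol)=> st.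
  by case: oAB => -> /=; rewrite oA oB !pass_over //= andbT => /andP[/eqP<- /eqP<-].
have memE e : e \in [:: s; t; u] -> forall p, p \in fwd e ->
    p \in weave fwd [:: s; t; u] w1 w2 w3 w4.
  rewrite !inE => el p pe; rewrite (perm_mem (weave_perm _ _ _ _ _ _ _)) mem_cat.
  by case/or3P: el => /eqP E; rewrite -E !mem_cat pe ?orbT.
apply: (@many_transfer k k _ _ F) => [[y s0] col|[y s0] [y' s0'] /andP[/yAB E _]
  /andP[/yAB E' _]].
  refine (coloured_weave (y' := (F (y, s0)).1) _ _ col) => [e st el ok|p pw kp].
    apply: (layered_edge L _ el ok); case/andP: col => col _; exact: yAB col.
  rewrite /= recolour_other //; apply/eqP=> pC.
  (* Both passages of the recoloured crossing are on the triangle, so the rest of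
     the word does not see the new colour. *)
  have : p \in fwd s ++ fwd t ++ fwd u.
    have inE' e q : e \in [:: o; m; b] -> q \in fwd e -> q \in fwd s ++ fwd t ++ fwd u.
      rewrite -El => el qe; have: q \in [seq p' | e' <- [:: s; t; u], p' <- fwd e'].
        by apply/allpairsPdep; exists e, q.
      by [].
    case/esym/same_label: pC => ->.
      apply: (inE' m); first by rewrite !inE eqxx ?orbT.
      by case: mAC => ->; rewrite !inE eqxx ?orbT.
    apply: (inE' b); first by rewrite !inE eqxx ?orbT.
    by case: uBC => ->; rewrite !inE eqxx ?orbT.
  move=> pin; case/andP: G => + _.
  rewrite (perm_uniq (weave_perm _ _ _ _ _ _ _)) cat_uniq => /and3P[_ /negP no _].
  by apply: no; apply/hasP; exists p.
case=> /= Es Ey; split=> //= p pw kp.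
have yA : y A.1 = y' A.1.
  have := Ey A; rewrite !recolour_other //; apply.
    rewrite -(perm_mem (weave_bwd_perm _ _ _ _ _ _ _)) (memE _ ol) //.
    by case: oAB => ->; rewrite !inE eqxx ?orbT.
  by move: oA; rewrite /is_over; case: (k A.1).
have := Ey p; rewrite -(perm_mem (weave_bwd_perm _ _ _ _ _ _ _)) => /(_ pw kp).
have [->|pC] := eqVneq p.1 C.1; last by rewrite !recolour_other.
by rewrite !recolour_same yA => /addrI/oppr_inj.
Qed.

(** If one side is virtual all along, each side carries a virtual crossing, and its
    two passages commute. *)
Lemma many_weave T k (s t u : edge) w1 w2 w3 w4 :
    gauss_word (weave fwd [:: s; t; u] w1 w2 w3 w4) ->
    triangular_face s t u \/ triangular_face s u t ->
    kinds3 k [:: s; t; u] ->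
  many_colourings T k (weave fwd [:: s; t; u] w1 w2 w3 w4) ->
  many_colourings T k (weave bwd [:: s; t; u] w1 w2 w3 w4).
Proof.
move=> G tri /orP[kin|kin].
  have U : uniq (fwd s ++ fwd t ++ fwd u).
    case/andP: G; rewrite (perm_uniq (weave_perm _ _ _ _ _ _ _)).
    by rewrite cat_uniq => /andP[].
  have [A [B [C L]]] := layeredP U tri kin.
  exact: many_layered L.
have virt := virtual_edges tri kin.
apply: (@many_transfer _ _ _ _ id) => [[y s0]|e e' _ _ [Es Ey]].
  apply: coloured_weave => // e st /virt.
  case: e => p q /=; rewrite /walk /= /is_virtual /pass /is_over /is_under.
  by case: (k p.1) => [op|] /=; case: (k q.1) => [oq|] //= _; rewrite !andbT.
split=> // p pw kp; apply: Ey => //.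
by rewrite -(perm_mem (weave_bwd_perm _ _ _ _ _ _ _)).
Qed.

Lemma many_move3 T k (s t u : edge) w1 w2 w3 w4 :
    gauss_word (weave fwd [:: s; t; u] w1 w2 w3 w4) ->
    gauss_word (weave bwd [:: s; t; u] w1 w2 w3 w4) ->
    triangular_face s t u \/ triangular_face s u t ->
    kinds3 k [:: s; t; u] ->
  many_colourings T k (weave fwd [:: s; t; u] w1 w2 w3 w4) <->
  many_colourings T k (weave bwd [:: s; t; u] w1 w2 w3 w4).
Proof.
move=> G G' tri kin; split; first exact: many_weave.
have bwdK : weave fwd [:: s; t; u] w1 w2 w3 w4 =
  weave bwd [:: rev_edge s; rev_edge t; rev_edge u] w1 w2 w3 w4.
  by case: s t u {G G' tri kin} => ? ? [? ?] [? ?].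
rewrite bwdK -weave_rev; apply: many_weave => //.
- by case: tri => /triangular_rev tri; [left | right].
- by rewrite kinds3_rev.
Qed.

Lemma coloured_rot k y s w1 w2 : coloured k (w1 ++ w2) (y, s) ->
  coloured k (w2 ++ w1) (y, walk k y s w1).
Proof.
rewrite /coloured !over_ok_cat !walk_cat /=.
by case/andP=> /andP[ok1 ok2] /eqP E; rewrite ok2 E ok1 eqxx.
Qed.

Lemma walk_inj k y s s' w : walk k y s w = walk k y s' w -> s = s'.
Proof.
elim: w s s' => //= p w IH s s' /IH; rewrite /pass; case: ifP => // _.
by move=> /addrI/oppr_inj.
Qed.

(** Moving the base point along [w1] replaces the base colour by the one which the
    strand has after [w1]. *)
Lemma many_swap T k w1 w2 :
  many_colourings T k (w1 ++ w2) -> many_colourings T k (w2 ++ w1).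
Proof.
apply: (@many_transfer _ _ _ _ (fun e => (e.1, walk k e.1 e.2 w1))).
  by case=> y s; apply: coloured_rot.
case=> y s [y' s'] _ _ [/= Es Ey]; split=> /= [|p pw]; last first.
  by apply: Ey; move: pw; rewrite !mem_cat orbC.
apply: (@walk_inj k y s s' w1); rewrite Es; apply: eq_walk => // p pw kp.
by apply/esym/Ey => //; rewrite mem_cat pw orbT.
Qed.

Lemma many_rot T k i w : many_colourings T k (rot i w) <-> many_colourings T k w.
Proof.
rewrite -{2}[w](cat_take_drop i) /rot; split; exact: many_swap.
Qed.

Lemma coloured_map k k' y y' s w (f : nat -> nat) :
    (forall p, p \in w -> k' (f p.1) = k p.1) ->
    (forall p, p \in w -> y' (f p.1) = y p.1) ->
  coloured k' [seq (f p.1, p.2) | p <- w] (y', s) = coloured k w (y, s).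
Proof.
move=> Ek Ey; rewrite /coloured /=.
suff E st : over_ok k' y' st [seq (f p.1, p.2) | p <- w] = over_ok k y st w /\
      walk k' y' st [seq (f p.1, p.2) | p <- w] = walk k y st w.
  by have [-> ->] := E s.
elim: w st Ek Ey => //= p w IH st Ek Ey.
have [||-> ->] := IH (pass k' y' st (f p.1, p.2)).
- by move=> q qw; apply: Ek; rewrite inE qw orbT.
- by move=> q qw; apply: Ey; rewrite inE qw orbT.
rewrite /pass /is_over /is_under /=.
by rewrite Ek ?Ey ?mem_head.
Qed.

(** The relabelling is injective but maybe not surjective; [g] inverts it on the
    labels in use. *)
Lemma many_relabel T k k' w f :
    injective f -> (forall p, p \in w -> k' (f p.1) = k p.1) ->
  many_colourings T k w <-> many_colourings T k' [seq (f p.1, p.2) | p <- w].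
Proof.
move=> injf Ek; split.
  pose g c := nth 0%N (labels w) (index c (map f (labels w))).
  have gK p : p \in w -> g (f p.1) = p.1.
    move=> pw; rewrite /g index_map // nth_index //; exact: map_f.
  apply: (@many_transfer _ _ _ _ (fun e => (e.1 \o g, e.2))) => [[y s]|].
    by rewrite (@coloured_map k k' y) // => p pw /=; rewrite gK.
  case=> y s [y' s'] _ _ [/= Es Ey]; split=> //= p pw kp.
  have := Ey (f p.1, p.2); rewrite /= gK // Ek //; apply => //.
  by apply/mapP; exists p.
apply: (@many_transfer _ _ _ _ (fun e => (e.1 \o f, e.2))) => [[y s]|].
  by rewrite (@coloured_map k k' (y \o f)).
case=> y s [y' s'] _ _ [/= Es Ey]; split=> //= q /mapP[p pw ->] /=.
by rewrite Ek // => kp; apply: Ey.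
Qed.

Theorem many_elementary T D D' : elementary_move D D' ->
  many_colourings T (kind D) (word D) <-> many_colourings T (kind D') (word D').
Proof.
have gD' := word_gauss D'; have gD := word_gauss D.
case=> -[].
- move=> f injf Ew Ek _; rewrite Ew; exact: many_relabel.
- move=> i p q u v _ _ -> Ek _; rewrite (many_same_kinds _ Ek).
  by apply: iff_sym; apply: many_rot.
- move=> c b w1 w2 Ew Ew' Ek _; rewrite (many_same_kinds _ Ek) Ew Ew'.
  rewrite Ew' in gD'.
  have : c \notin labels (w1 ++ w2).
    case/andP: gD' => + _; rewrite uniq_catCA => U.
    by apply: (uniq_labels (p := (c, b)) U); rewrite !inE eqxx ?orbT.
  by rewrite /labels map_cat mem_cat negb_or => /andP[? ?]; apply: many_kink.
- move=> a c b r w1 w2 w3 Ew Ew' kc Ek _; rewrite (many_same_kinds _ Ek) Ew Ew'.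
  apply: many_move2 => // d dw; apply/negP=> dac; move: gD'; rewrite Ew' => /andP[+ _].
  set X := [:: _; _]; set Y := if r then _ else _.
  have XY e b' : e \in [:: a; c] -> (e, b') \in X ++ Y.
    exact: bigon_mem.
  rewrite (perm_uniq (_ : perm_eq _ ((X ++ Y) ++ w1 ++ w2 ++ w3))); last first.
    by apply/permP=> x; rewrite !count_cat; lia.
  move=> U; move: dw; apply/negP;
    exact: (uniq_labels (p := (d, true)) U (XY _ _ dac) (XY _ _ dac)).
- move=> s t u w1 w2 w3 w4 Ew Ew' tri kin Ek _.
  rewrite -(@many_same_kinds _ (kind D)) => [|p pw'].
    by rewrite Ew Ew'; rewrite Ew in gD; rewrite Ew' in gD';
      apply: (@many_move3 _ _ s t u).
  apply: Ek; move: pw'; rewrite Ew Ew'.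
  by rewrite (perm_mem (weave_bwd_perm s t u w1 w2 w3 w4)).
Qed.

Lemma many_equivalent T D D' : equivalent D D' ->
  many_colourings T (kind D) (word D) <-> many_colourings T (kind D') (word D').
Proof.
elim=> [{}D {}D' /many_elementary //|//|{}D {}D' _ IH|D1 D2 D3 _ IH1 _ IH2].
  exact: iff_sym.
exact: iff_trans IH1 IH2.
Qed.

(** * Colourings and crossing changes *)

(** A circle has a single arc. *)
Lemma many_empty T k : many_colourings T k [::] -> (#|T| <= #|V|)%N.
Proof.
case=> phi [_ inj]; apply: (@leq_card _ _ (fun i => (phi i).2)) => i j Es.
exact: inj.
Qed.

Lemma pigeonhole (T U : finType) (f : T -> U) (u0 : U) :
  exists u, (#|T| <= #|U| * #|[pred i | f i == u]|)%N.
Proof.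
have [i0 _|noT] := pickP (@predT T); last first.
  by exists u0; rewrite (@eq_card0 _ T).
pose c u := #|[pred i | f i == u]|.
exists [arg max_(u > f i0) c u]; case: arg_maxnP => // u _ umax.
rewrite -sum1_card (partition_big f predT) //= -sum_nat_const leq_sum // => v _.
by rewrite sum1_card; apply: umax.
Qed.

Lemma pass_sub k y y' s s' p :
  pass k (fun c => y c - y' c) (s - s') p = pass k y s p - pass k y' s' p.
Proof. by rewrite /pass; case: ifP => // _; ring. Qed.

Lemma walk_sub k y y' s s' w :
  walk k (fun c => y c - y' c) (s - s') w = walk k y s w - walk k y' s' w.
Proof.
by elim: w s s' => //= p w IH s s'; rewrite /walk /= pass_sub; apply: IH.
Qed.

Lemma over_ok_sub k y y' s s' w :
    over_ok k y s w -> over_ok k y' s' w ->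
  over_ok k (fun c => y c - y' c) (s - s') w.
Proof.
elim: w s s' => //= p w IH s s' /andP[h /IH{}IH] /andP[h' /IH{}IH].
rewrite pass_sub IH andbT; apply/implyP=> op.
by rewrite (eqP (implyP h op)) (eqP (implyP h' op)).
Qed.

Definition sub_colouring (e e' : (nat -> V) * V) := (fun c => e.1 c - e'.1 c, e.2 - e'.2).

Lemma coloured_sub k w e e' :
  coloured k w e -> coloured k w e' -> coloured k w (sub_colouring e e').
Proof.
case/andP=> ok1 /eqP E1 /andP[ok2 /eqP E2].
by rewrite /coloured over_ok_sub //= walk_sub E1 E2.
Qed.

(** If the strand reaches the under passage of [c] with the over colour, passing [c]
    changes nothing, over, under or virtually.  Away from that passage, the kind of
    [c] only matters at its over passage, where the two colours agree by
    definition. *)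
Lemma change_piece k k' y s w c o :
    (forall d, d != c -> k' d = k d) -> k c = Some o ->
    (c, ~~ o) \notin w -> over_ok k y s w ->
  over_ok k' y s w /\ walk k' y s w = walk k y s w.
Proof.
move=> Ek kc; elim: w s => //= p w IH s; rewrite inE negb_or => /andP[pc cw].
case/andP=> okp ok.
have Ep : pass k' y s p = pass k y s p /\ (is_over k' p ==> (s == y p.1)).
  have [E|Ne] := eqVneq p.1 c; last by rewrite /pass /is_under /is_over !Ek.
  have Eo : p.2 = o.
    by move: pc E; case: p {okp ok} => d b /= + Ed; rewrite Ed xpair_eqE eqxx;
      case: b o {kc cw IH} => -[].
  move: okp; rewrite /pass /is_over /is_under E kc Eo eqxx /= => /eqP <-.
  rewrite eqxx implybT addrK.
  by split=> //; rewrite if_same; case: (o) => /=; rewrite ?if_same.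
have [Ep1 Ep2] := Ep.
by rewrite Ep2 /walk /= Ep1; apply: IH.
Qed.

(** The colourings with a given difference between the under and the over colour at
    [c] are a coset of those where the difference is [0], and these do not depend on
    the kind of [c].  The most frequent difference is taken by at least one
    colouring in [#|V|]. *)
Lemma many_change_crossing T k k' w c o :
    uniq w -> (c, ~~ o) \in w -> k c = Some o -> (forall d, d != c -> k' d = k d) ->
    many_colourings T k w ->
  exists2 T' : finType, (#|T| <= #|V| * #|T'|)%N & many_colourings T' k' w.
Proof.
move=> U cw kc Ek [phi [col inj]].
have [i0 _|noT] := pickP (@predT T); last first.
  exists T; first by rewrite (@eq_card0 _ T).
  by exists phi; split=> i; have := noT i.
case/splitPr: cw U col inj => w1 w2;
  rewrite cat_uniq => /and3P[_ hasN /= /andP[cw2 _]] col inj.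
have cw1 : (c, ~~ o) \notin w1 by apply: contra hasN => h; apply/orP; left.
pose gap (e : (nat -> V) * V) := walk k e.1 e.2 w1 - e.1 c.
have [v leT] := pigeonhole (gap \o phi) 0.
have [i1 /eqP gi1|no] := pickP [pred i | gap (phi i) == v]; last first.
  by move: leT; rewrite (eq_card0 no) muln0 leqn0 => /eqP/card0_eq/(_ i0).
exists {i | gap (phi i) == v}; first by rewrite card_sig.
exists (fun i => sub_colouring (phi (val i)) (phi i1)).
have wk0 e : coloured k (w1 ++ (c, ~~ o) :: w2) e -> gap e = 0 ->
    coloured k' (w1 ++ (c, ~~ o) :: w2) e /\ walk k' e.1 e.2 w1 = walk k e.1 e.2 w1.
  case: e => y s; rewrite /gap /coloured /= !over_ok_cat !walk_cat.
  case/andP=> /= /andP[ok1 /andP[_ ok2]] Ew /eqP; rewrite subr_eq0 => /eqP Ey.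
  have [-> W1] := change_piece Ek kc cw1 ok1; rewrite W1; split=> //.
  move: ok2 Ew; rewrite Ey /walk /= -!/(walk _ _ _ _).
  have Epass k0 : pass k0 y (y c) (c, ~~ o) = y c.
    by rewrite /pass /= addrK if_same.
  rewrite !Epass eqxx implybT /= => ok2 Ew.
  by have [-> ->] := change_piece Ek kc cw2 ok2.
have gap0 i : gap (phi i) == v -> gap (sub_colouring (phi i) (phi i1)) = 0.
  move/eqP=> gi; rewrite /gap /sub_colouring /= walk_sub.
  move: gi1 gi; rewrite /= /gap => <-; set a := walk _ _ _ _; set b := walk _ _ _ _.
  move=> E; rewrite -[RHS](subrr (a - (phi i).1 c)) {2}E; ring.
split=> [[i gi]|[i gi] [j gj] /= [/= Es Ey]].
  by have [] := wk0 _ (coloured_sub (col i) (col i1)) (gap0 i gi).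
(* If [c] has become virtual, its colour is recovered as the colour with which
   the strand reaches the under passage. *)
apply: val_inj; apply: inj; split=> /=; first exact: addIr Es.
move=> p pw kp; have [E|Ne] := eqVneq p.1 c; last first.
  by apply: (@addIr _ (- (phi i1).1 p.1)); apply: Ey => //; rewrite Ek.
have [_ Wi] := wk0 _ (coloured_sub (col i) (col i1)) (gap0 i gi).
have [_ Wj] := wk0 _ (coloured_sub (col j) (col i1)) (gap0 j gj).
have /eqP := gap0 i gi; have /eqP := gap0 j gj.
rewrite /gap !subr_eq0 -Wi -Wj /= => /eqP Ej /eqP Ei.
rewrite E; apply: (@addIr _ (- (phi i1).1 c)); rewrite -Ei -Ej Es.
apply: eq_walk => // q qw kq; apply: Ey => //; rewrite mem_cat qw //.
Qed.

Lemma many_change_crossings T (L : seq nat) k k' w :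
    gauss_word w -> uniq L ->
    (forall c, c \in L -> c \in labels w /\ k c != None) ->
    (forall d, d \notin L -> k' d = k d) ->
    many_colourings T k w ->
  exists2 T' : finType, (#|T| <= #|V| ^ size L * #|T'|)%N & many_colourings T' k' w.
Proof.
move=> G; elim: L k T => [|c L IH] k T /=.
  move=> _ _ Ek; exists T; first by rewrite mul1n.
  by apply: many_eq H => p _; rewrite Ek.
case/andP=> cL UL inL Ek many.
pose k1 d := if d == c then k' c else k d.
have [cw] := inL c (mem_head _ _).
case kc: (k c) => [o|//] _.
have mw : (c, ~~ o) \in w.
  case/mapP: cw => p pw Ec; have : mate p \in w by rewrite mate_mem.
  by move: pw; rewrite Ec; case: p {Ec} => d [] /=; case: o {kc}.
case/andP: (G) => U _.
have [|T1 leT1 many1] := @many_change_crossing T k k1 w c o U mw kc _ many.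
  by move=> d; rewrite /k1 => /negPf->.
have [|d dL|T' leT' many'] := IH k1 T1 UL _ _ many1.
- move=> d dL; have [dw kd] := inL d (mem_behead (s := c :: L) dL).
  by split=> //; rewrite /k1; case: (d =P c) => // Ed; rewrite -Ed dL in cL.
- by rewrite /k1; case: (d =P c) => [->//|/eqP dc]; rewrite Ek // inE negb_or dc.
exists T' => //; apply: leq_trans leT1 _.
by rewrite expnS -mulnA leq_mul2l leT' orbT.
Qed.

Theorem changed_bound T D D' m n :
    changed m n D D' -> presents_trivial_knot D' ->
    many_colourings T (kind D) (word D) ->
  (#|T| <= #|V| ^ (m + n).+1)%N.
Proof.
case=> Ew _ Ek Em En [O O0 eqO] many.
pose L := [seq c <- crossings D | kind D' c != kind D c].
have labelP c : ((c, true) \in word D) = (c \in labels (word D)).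
  apply/idP/mapP => [cw|[[d b] /= pw ->]]; first by exists (c, true).
  by case: b pw => // pw; rewrite -(mate_mem (d, true) (word_gauss D)).
have crossingP c : (c \in crossings D) = (kind D c != None) && (c \in labels (word D)).
  rewrite mem_filter -labelP; congr (_ && _).
  apply/mapP/idP => [[[d b]]|cw]; last by exists (c, true); rewrite // mem_filter.
  by rewrite mem_filter => /andP[/= bt pw] ->; case: b bt pw.
have sizeL : (size L <= m + n)%N.
  rewrite -Em -En size_filter -count_predUI; apply: leq_trans (leq_addr _ _).
  rewrite leq_eqVlt; apply/orP; left; apply/eqP; apply: eq_in_count => c.
  rewrite crossingP => /andP[kc /mapP[p pw Ec]]; have := Ek p pw.
  by rewrite -Ec !inE /= => /or3P[]/eqP->; case: (kind D c) kc => // -[].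
have UL : uniq L.
  apply: filter_uniq; apply: filter_uniq; rewrite map_inj_in_uniq.
    by apply: filter_uniq; case/andP: (word_gauss D).
  by move=> [d b] [d' b']; rewrite !mem_filter /= => /andP[+ _] /andP[+ _] ->; case: b;
    case: b'.
pose k' c := if c \in L then kind D' c else kind D c.
have [|d|T' leT many'] := @many_change_crossings T L (kind D) k' _ (word_gauss D) UL _ _
  many.
- by move=> c; rewrite mem_filter crossingP => /and3P[_ -> ->].
- by rewrite /k' => /negPf->.
apply: leq_trans leT _; rewrite expnSr leq_mul //; last first.
  apply: many_empty (kind O) _; rewrite -O0 (many_equivalent _ eqO) Ew.
  apply: many_eq many' => p pw; rewrite /k'.
  case: ifP => // /negbT; rewrite mem_filter crossingP map_f // andbT negb_and !negbK.
  case/orP=> /eqP E //; have := Ek p pw.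
  by rewrite E !inE /= !orbb => /eqP.
by rewrite leq_pexp2l //; apply/card_gt0P; exists 0.
Qed.

End Colouring.

(** * The flat index *)

Section FlatIndex.

Local Open Scope ring_scope.

Implicit Types (h : passage -> int).

(** With these increments, levels are the Alexander numbering of the flat curve
    whose only crossings are the real ones: the level is raised by [1] by a strand
    coming from the right. *)
Definition rise k (p : passage) : int :=
  if is_virtual k p then 0 else if p.2 then 1 else -1.

Definition total_rise k w : int := \sum_(p <- w) rise k p.

Fixpoint level k w (p : passage) : int :=
  if w is q :: w' then if p == q then 0 else rise k q + level k w' p else 0.

(** As for colourings, levels are determined by the value [x] on the base edge, and
    a part of the word constrains only its own passages; this makes the moves local,
    which they are not for the function [level]. *)
Fixpoint levelled k h (x : int) w : bool :=
  if w is p :: w' then (h p == x) && levelled k h (x + rise k p) w' else true.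

(** For [p = (c, true)], the argument of [f] is the sum of the rises strictly between
    [p] and [mate p]: this is the index of [c].  The formula is also right when
    [mate p] comes first, as the rises of a whole word cancel. *)
Definition index_sum (f : int -> int) k h w : int :=
  \sum_(p <- w | p.2 && ~~ is_virtual k p) f (h (mate p) - h p - 1).

Definition flat_index f k w := index_sum f k (level k w) w.

Lemma levelled_cat k h x w1 w2 : levelled k h x (w1 ++ w2) =
  levelled k h x w1 && levelled k h (x + total_rise k w1) w2.
Proof.
elim: w1 x => [|p w1 IH] x /=; first by rewrite /total_rise big_nil addr0.
by rewrite IH /total_rise big_cons addrA andbA.
Qed.

Lemma levelledP k h x w : uniq w ->
  reflect {in w, forall p, h p = x + level k w p} (levelled k h x w).
Proof.
elim: w x => [|q w IH] x /=; first by constructor.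
case/andP=> qw /IH{}IH; apply: (iffP andP) => [[/eqP hq /IH hw] p|hw].
  rewrite inE; case: (eqVneq p q) => [-> _|pq /= pw]; first by rewrite addr0.
  by rewrite hw // addrA.
split; first by rewrite hw ?mem_head // eqxx addr0.
apply/IH => p pw; rewrite hw ?inE ?pw ?orbT //.
by case: eqP => [pq|_]; [rewrite -pq pw in qw | rewrite addrA].
Qed.

Lemma levelled_level k w : uniq w -> levelled k (level k w) 0 w.
Proof. by move=> U; apply/levelledP => // p; rewrite add0r. Qed.

Lemma levelled_eq k h x w p : uniq w -> levelled k h x w -> p \in w ->
  h p = x + level k w p.
Proof. by move=> U /(levelledP _ _ _ U); apply. Qed.

(** Only differences of levels enter, so the level of the base edge is free. *)
Lemma index_sum_unique f k w h h' x x' : gauss_word w ->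
  levelled k h x w -> levelled k h' x' w -> index_sum f k h w = index_sum f k h' w.
Proof.
move=> G; have /andP[U _] := G; move=> /(levelledP _ _ _ U) hw /(levelledP _ _ _ U) hw'.
rewrite /index_sum big_seq_cond [RHS]big_seq_cond.
apply: eq_bigr => p /andP[pw _]; rewrite !hw ?hw' ?mate_mem //.
by congr (f _); ring.
Qed.

Lemma flat_indexE f k w h x : gauss_word w ->
  levelled k h x w -> flat_index f k w = index_sum f k h w.
Proof.
move=> G hw; apply: index_sum_unique hw => //.
by apply: levelled_level; case/andP: G.
Qed.

Lemma index_sum_cat f k h w1 w2 :
  index_sum f k h (w1 ++ w2) = index_sum f k h w1 + index_sum f k h w2.
Proof. exact: big_cat. Qed.

Lemma total_rise_cat k w1 w2 :
  total_rise k (w1 ++ w2) = total_rise k w1 + total_rise k w2.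
Proof. exact: big_cat. Qed.

Lemma eq_levelled k k' h x w : (forall p, p \in w -> is_virtual k p = is_virtual k' p) ->
  levelled k h x w = levelled k' h x w.
Proof.
elim: w x => //= p w IH x Ek; rewrite /rise (Ek p) ?mem_head // IH // => q qw.
by apply: Ek; rewrite inE qw orbT.
Qed.

Lemma eq_flat_index f k k' w : gauss_word w ->
    (forall p, p \in w -> is_virtual k p = is_virtual k' p) ->
  flat_index f k w = flat_index f k' w.
Proof.
move=> G Ek; have U : uniq w by case/andP: G.
rewrite (@flat_indexE f k w (level k' w) 0) //; last first.
  by rewrite (eq_levelled _ _ Ek) levelled_level.
rewrite /flat_index /index_sum big_seq_cond [RHS]big_seq_cond.
by apply: eq_bigl => p; case pw: (p \in w); rewrite // Ek.
Qed.

Variable f : int -> int.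
Hypothesis f_odd : forall x, f (- x) = - f x.

Lemma odd0 : f 0 = 0.
Proof. by have := f_odd 0; rewrite oppr0; move: (f 0) => z; lia. Qed.

Definition real_term k h p := if p.2 && ~~ is_virtual k p then f (h (mate p) - h p - 1)
  else 0.

Lemma index_sum2 k h p q :
  index_sum f k h [:: p; q] = real_term k h p + real_term k h q.
Proof. rewrite /index_sum !big_cons big_nil /= /real_term.
by case: ifP => _; case: ifP => _; rewrite ?addr0 ?add0r. Qed.

Lemma total_rise2 k p q : total_rise k [:: p; q] = rise k p + rise k q.
Proof. by rewrite /total_rise !big_cons big_nil addr0. Qed.

(** Nothing happens between the two passages of a kink: its crossing has index [0]. *)
Lemma flat_index_kink k c b w1 w2 :
    gauss_word (w1 ++ w2) -> gauss_word (w1 ++ [:: (c, b); (c, ~~ b)] ++ w2) ->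
  flat_index f k (w1 ++ [:: (c, b); (c, ~~ b)] ++ w2) = flat_index f k (w1 ++ w2).
Proof.
move=> G G'; have /andP[U' _] := G'.
have := levelled_level k U'; rewrite [LHS]/flat_index; move: (level _ _) => h hw.
move: (hw); rewrite !levelled_cat => /and3P[h1 hX h2].
have rX : total_rise k [:: (c, b); (c, ~~ b)] = 0.
  by rewrite total_rise2 /rise /is_virtual /=; case: (_ == None);
    case: b {G' U' hw hX h2}.
rewrite rX addr0 in h2.
rewrite (@flat_indexE f k (w1 ++ w2) h 0) //; last by rewrite levelled_cat h1.
rewrite !index_sum_cat index_sum2;
  suff -> : real_term k h (c, b) + real_term k h (c, ~~ b) = 0.
  by rewrite add0r.
move: hX; rewrite /= /real_term /rise /is_virtual /=.
case: (_ == None) => /=; first by rewrite ?andbF ?addr0.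
case: b {G' U' hw rX} => /= /and3P[/eqP -> /eqP -> _]; rewrite ?addr0 ?add0r.
  by rewrite -odd0; congr (f _); ring.
by rewrite -odd0; congr (f _); ring.
Qed.

(** The two crossings of a clasp have opposite indices, and [f] is odd. *)
Lemma flat_index_move2 k a c b r w1 w2 w3 :
    let X := [:: (a, b); (c, ~~ b)] in
    let Y := if r then [:: (c, b); (a, ~~ b)] else [:: (a, ~~ b); (c, b)] in
    k c = omap negb (k a) ->
    gauss_word (w1 ++ w2 ++ w3) -> gauss_word (w1 ++ X ++ w2 ++ Y ++ w3) ->
  flat_index f k (w1 ++ X ++ w2 ++ Y ++ w3) = flat_index f k (w1 ++ w2 ++ w3).
Proof.
move=> X Y kc G G'; have /andP[U' _] := G'.
have := levelled_level k U'; rewrite [LHS]/flat_index; move: (level _ _) => h hw.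
move: (hw); rewrite !levelled_cat => /and5P[h1 hX h2 hY h3].
have vc b' b'': is_virtual k (c, b') = is_virtual k (a, b'').
  by rewrite /is_virtual /= kc; case: (k a).
have rX : total_rise k X = 0.
  by rewrite total_rise2 /rise (vc _ b) /= /is_virtual /=; case: (_ == None); case: (b).
have rY : total_rise k Y = 0.
  by rewrite /Y; case: (r); rewrite total_rise2 /rise (vc _ (~~ b)) /= /is_virtual /=;
     case: (_ == None); case: (b).
rewrite rY rX !addr0 in h2 h3 hY.
rewrite (@flat_indexE f k (w1 ++ w2 ++ w3) h 0) //; last by rewrite !levelled_cat h1 h2.
rewrite !index_sum_cat.
suff : index_sum f k h X + index_sum f k h Y = 0.
  by move=> XY; transitivity (index_sum f k h w1 + index_sum f k h w2 +
    (index_sum f k h X + index_sum f k h Y) + index_sum f k h w3); [ring | rewrite XY;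
      ring].
move: hX hY; move: (0 + _) (0 + _ + _) => x y; rewrite /X /Y.
clear - f_odd vc.
case: r; rewrite !index_sum2 /= /real_term /rise !(vc _ true) /is_virtual /=.
all: case: (_ == None) => /=; rewrite ?andbF //.
all: case: b => /= /and3P[/eqP E1 /eqP E2 _] /and3P[/eqP E3 /eqP E4 _];
  rewrite ?addr0 ?add0r.
all: rewrite ?E1 ?E2 ?E3 ?E4.
all: apply/eqP; rewrite addr_eq0 -f_odd; apply/eqP; congr (f _); ring.
Qed.

(** The top and the bottom strands together meet all three crossings, which are then
    real; a virtual strand meets two of them, which leaves at most one real. *)
Lemma triangle_real k p q r (s t u : edge) :
    edge_of s (mate r) p -> edge_of t (mate p) q -> edge_of u (mate q) r ->
    kinds3 k [:: s; t; u] ->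
  let vp := is_virtual k p in let vq := is_virtual k q in let vr := is_virtual k r in
  [|| ~~ vp && ~~ vq && ~~ vr, vp && vq, vq && vr | vr && vp].
Proof.
move=> Hs Ht Hu; rewrite /kinds3 /kinds_RIII /kinds_VRIII_VRIV /=.
rewrite !(all_along_of _ Hs, all_along_of _ Ht, all_along_of _ Hu).
rewrite /is_over /is_under /is_virtual /=.
case: p.2 q.2 r.2 => -[] [];
  by case: (k p.1) => [[]|]; case: (k q.1) => [[]|]; case: (k r.1) => [[]|].
Qed.

Definition directed (d : bool) (p q : passage) : edge := if d then (p, q) else (q, p).

Lemma directed_edge_of d p q : edge_of (directed d p q) p q.
Proof. by case: d; [left | right]. Qed.

Lemma triangular_directed s t u : triangular_face s t u ->
  exists p q r d e g, [/\ s = directed d (mate r) p, t = directed e (mate p) q &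
    u = directed g (mate q) r] /\
    [/\ (p.2 == d) = e, (q.2 == e) = g & (r.2 == g) = d].
Proof.
case=> d [e [g [[Hp dp] [Hq dq] [Hr dr]]]].
exists (if d then s.2 else s.1), (if e then t.2 else t.1), (if g then u.2 else u.1).
exists d, e, g; split; last by split.
rewrite Hp Hq Hr; split.
- by case: s {Hp Hr dp dr} => ? ?; case: d.
- by case: t {Hp Hq dp dq} => ? ?; case: e.
- by case: u {Hq Hr dq dr} => ? ?; case: g.
Qed.

Definition sign (b : bool) : int := if b then 1 else -1.

(** The turning rule [(x == d) = e] is multiplicative in signs, so the condition
    that the walk around the triangle closes up determines each sign from the
    others. *)
Lemma sign_cycle (x y z d e g : bool) : (x == d) = e -> (y == e) = g -> (z == g) = d ->
  sign d * sign z = sign e * sign y.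
Proof. by move=> <- <-; case: x y z d => [] [] [] []. Qed.

(** Exchanging two passages changes the level of each by the rise of the other.  At a
    crossing of the triangle the two levels change by the same amount: by the rise
    at one of the two other crossings each time, with the sign given by
    [sign_cycle]. *)
Lemma triangle_levels k h h' (s t u : edge) :
    triangular_face s t u -> kinds3 k [:: s; t; u] ->
    (forall e, e \in [:: s; t; u] ->
       h' e.1 = h e.1 + rise k e.2 /\ h' e.2 = h e.2 - rise k e.1) ->
  forall e p, e \in [:: s; t; u] -> p \in fwd e -> ~~ is_virtual k p ->
    h' (mate p) - h' p = h (mate p) - h p.
Proof.
move=> /triangular_directed[p [q [r [d [e [g [[-> -> ->] [dp dq dr]]]]]]]] kin hh.
have shift d' x y : directed d' x y \in [:: directed d (mate r) p;
      directed e (mate p) q; directed g (mate q) r] ->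
    h' x = h x + sign d' * rise k y /\ h' y = h y - sign d' * rise k x.
  by move/hh; case: d' => -[/= -> ->]; rewrite /sign !(mul1r, mulN1r, opprK).
have [|sr sp] := shift d (mate r) p; first by rewrite mem_head.
have [|sp' sq] := shift e (mate p) q; first by rewrite !inE eqxx orbT.
have [|sq' sr'] := shift g (mate q) r; first by rewrite !inE eqxx !orbT.
have real := triangle_real (directed_edge_of _ _ _) (directed_edge_of _ _ _)
  (directed_edge_of _ _ _) kin.
have rise_mate x : rise k (mate x) = - rise k x.
  by rewrite /rise /is_virtual /=; case: ifP; case: (x.2).
rewrite rise_mate in sp; rewrite rise_mate in sq; rewrite rise_mate in sr'.
(* If [x] is real, the two others are either both real or both virtual. *)
have E x y z (ds dt : bool) :
    [|| ~~ is_virtual k x && ~~ is_virtual k y && ~~ is_virtual k z,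
      is_virtual k x && is_virtual k y, is_virtual k y && is_virtual k z
    | is_virtual k z && is_virtual k x] ->
    sign ds * sign z.2 = sign dt * sign y.2 ->
    ~~ is_virtual k x -> sign ds * rise k z = sign dt * rise k y.
  rewrite /rise; case: (is_virtual k x) => //=.
  by case: (is_virtual k y); case: (is_virtual k z); rewrite // ?mulr0.
have Ep := E p q r d e real (sign_cycle dp dq dr).
have Eq := E q r p e g _ (sign_cycle dq dr dp).
have Er := E r p q g d _ (sign_cycle dr dp dq).
have {}Eq : ~~ is_virtual k q -> sign e * rise k p = sign g * rise k r.
  by apply: Eq; move: real; do 3!case: (is_virtual k _).
have {}Er : ~~ is_virtual k r -> sign g * rise k q = sign d * rise k p.
  by apply: Er; move: real; do 3!case: (is_virtual k _).
have Dp : ~~ is_virtual k p -> h' (mate p) - h' p = h (mate p) - h p.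
  by move/Ep=> E1; rewrite sp sp' -E1; ring.
have Dq : ~~ is_virtual k q -> h' (mate q) - h' q = h (mate q) - h q.
  by move/Eq=> E1; rewrite sq sq' -E1; ring.
have Dr : ~~ is_virtual k r -> h' (mate r) - h' r = h (mate r) - h r.
  by move/Er=> E1; rewrite sr sr' -E1; ring.
have Dmate x : (~~ is_virtual k x -> h' (mate x) - h' x = h (mate x) - h x) ->
    ~~ is_virtual k (mate x) -> h' (mate (mate x)) - h' (mate x) = h (mate (mate x)) - h
      (mate x).
  by move=> D /D E1; rewrite mateK -[LHS]opprB E1 opprB.
have mem_directed d' x y z : z \in fwd (directed d' x y) -> z = x \/ z = y.
  by case: d'; rewrite !inE => /orP[]/eqP->; auto.
have mem3 (e1 e2 e3 e' : edge) : e' \in [:: e1; e2;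
  e3] -> [\/ e' = e1, e' = e2 | e' = e3].
  by rewrite !inE => /or3P[]/eqP->; [exact: Or31 | exact: Or32 | exact: Or33].
by move=> e' x /mem3[] -> /mem_directed[] ->; try exact: Dmate.
Qed.

Lemma levelled_weave k h h' x (s t u : edge) w1 w2 w3 w4 :
    uniq (weave fwd [:: s; t; u] w1 w2 w3 w4) ->
    levelled k h x (weave fwd [:: s; t; u] w1 w2 w3 w4) ->
    levelled k h' x (weave bwd [:: s; t; u] w1 w2 w3 w4) ->
  {in w1 ++ w2 ++ w3 ++ w4, h' =1 h} /\
  (forall e, e \in [:: s; t; u] ->
       h' e.1 = h e.1 + rise k e.2 /\ h' e.2 = h e.2 - rise k e.1).
Proof.
move=> U; rewrite /weave !levelled_cat.
have rE e : total_rise k (bwd e) = total_rise k (fwd e).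
  by rewrite !total_rise2 addrC.
rewrite !rE.
case/and5P=> h1 hs h2 ht /and3P[h3 hu h4] /and5P[h1' hs' h2' ht' /and3P[h3' hu' h4']].
have piece w y : uniq w -> levelled k h y w -> levelled k h' y w -> {in w, h' =1 h}.
  by move=> Uw hw hw' p pw; rewrite (levelled_eq Uw hw) ?(levelled_eq Uw hw').
have step e y : levelled k h y (fwd e) -> levelled k h' y (bwd e) ->
    h' e.1 = h e.1 + rise k e.2 /\ h' e.2 = h e.2 - rise k e.1.
  by move=> /= /and3P[/eqP-> /eqP-> _] /and3P[/eqP-> /eqP-> _]; split; ring.
have : uniq (w1 ++ w2 ++ w3 ++ w4).
  by move: U; rewrite (perm_uniq (weave_perm _ _ _ _ _ _ _)) cat_uniq => /and3P[].
rewrite !cat_uniq => /and5P[U1 _ U2 _ /and3P[U3 _ U4]]; split.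
  move=> p; rewrite !mem_cat => /or4P[].
  - exact: piece h1 h1' p.
  - exact: piece h2 h2' p.
  - exact: piece h3 h3' p.
  - exact: piece h4 h4' p.
move=> e; rewrite !inE => /or3P[]/eqP->.
- exact: step hs hs'.
- exact: step ht ht'.
- exact: step hu hu'.
Qed.

(** So a crossing off the triangle has both its passages off it, hence both its
    levels. *)
Lemma triangle_mate_closed (s t u : edge) p :
    p \in fwd s ++ fwd t ++ fwd u ->
    triangular_face s t u \/ triangular_face s u t ->
  mate p \in fwd s ++ fwd t ++ fwd u.
Proof.
move=> + tri; wlog tri' : t u {tri} / triangular_face s t u => [IH|].
  case: tri => tri; first exact: IH.
  by rewrite !mem_cat [(p \in fwd t) || _]orbC [(mate p \in fwd t) || _]orbC -!mem_cat;
    apply: IH.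
case/triangularP: tri' => a [b [c [Hs Ht Hu]]].
have mem_edge e x y z : edge_of e x y -> (z \in fwd e) = (z == x) || (z == y).
  by case=> ->; rewrite !inE // orbC.
have eq_mate x y : (mate x == y) = (x == mate y) by rewrite (can2_eq mateK mateK).
rewrite !mem_cat !(mem_edge _ _ _ _ Hs, mem_edge _ _ _ _ Ht, mem_edge _ _ _ _ Hu).
rewrite !eq_mate !mateK.
by do 6!case: (p == _).
Qed.

Lemma flat_index_move3 k (s t u : edge) w1 w2 w3 w4 :
    gauss_word (weave fwd [:: s; t; u] w1 w2 w3 w4) ->
    gauss_word (weave bwd [:: s; t; u] w1 w2 w3 w4) ->
    triangular_face s t u \/ triangular_face s u t ->
    kinds3 k [:: s; t; u] ->
  flat_index f k (weave fwd [:: s; t; u] w1 w2 w3 w4) =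
  flat_index f k (weave bwd [:: s; t; u] w1 w2 w3 w4).
Proof.
move=> G G' tri kin; have /andP[U _] := G; have /andP[U' _] := G'.
rewrite /flat_index.
set w := weave fwd _ _ _ _ _ in G U *; set w' := weave bwd _ _ _ _ _ in G' U' *.
have ww' : perm_eq w w' by apply: weave_bwd_perm.
have [same hh] := levelled_weave U (levelled_level k U) (levelled_level k U').
rewrite /index_sum -(perm_big _ ww') /= big_seq_cond [RHS]big_seq_cond.
apply: eq_bigr => p /and3P[pw _ vp]; congr (f (_ - _)).
pose six := fwd s ++ fwd t ++ fwd u.
have sixP q : reflect (exists2 e, e \in [:: s; t; u] & q \in fwd e) (q \in six).
  apply: (iffP idP) => [|[e es qe]].
    rewrite !mem_cat => /or3P[] qe.
    - by exists s; rewrite // !inE eqxx.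
    - by exists t; rewrite // !inE eqxx orbT.
    - by exists u; rewrite // !inE eqxx !orbT.
  have: q \in [seq p' | e' <- [:: s; t; u], p' <- fwd e'].
    by apply/allpairsPdep; exists e, q.
  by [].
have tri_levels e q : e \in [:: s; t; u] -> q \in fwd e -> ~~ is_virtual k q ->
    level k w' (mate q) - level k w' q = level k w (mate q) - level k w q.
  case: tri => tri; first exact: (triangle_levels tri kin hh).
  have sub e' : (e' \in [:: s; t; u]) = (e' \in [:: s; u; t]).
    by rewrite !inE [(e' == t) || _]orbC.
  rewrite sub; apply: (triangle_levels tri) => [|e']; last by rewrite -sub; apply: hh.
  by move: kin; rewrite /kinds3 /kinds_RIII /kinds_VRIII_VRIV /=;
    do 9!case: (all_along _ _).
have [/sixP[e es pe]|p6] := boolP (p \in six); first by rewrite (tri_levels e).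
have mp6 : mate p \notin six.
  apply: contra p6 => /triangle_mate_closed; rewrite mateK; apply.
  by case: tri => tri; [left | right].
have out q : q \in w -> q \notin six -> level k w' q = level k w q.
  rewrite (perm_mem (weave_perm _ _ _ _ _ _ _)) mem_cat => /orP[->//|qw] _.
  exact: same.
by rewrite !out // mate_mem.
Qed.

(** The two passages of a crossing have opposite rises. *)
Lemma total_rise_gauss k w : gauss_word w -> total_rise k w = 0.
Proof.
case/andP=> U /allP mw; suff E : total_rise k w = - total_rise k w.
  by move: E; move: (total_rise k w) => z; lia.
rewrite {1}/total_rise (perm_big [seq mate p | p <- w]) /=.
  rewrite big_map /total_rise -sumrN; apply: eq_bigr => p _.
  by rewrite /rise /is_virtual /=; case: (_ == None); rewrite ?oppr0 //; case: p.2.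
apply: uniq_perm => // [|p]; first by rewrite (map_inj_uniq (inv_inj mateK)).
apply/idP/mapP => [pw|[q qw ->]]; last exact: mw.
by exists (mate p); rewrite ?mateK //; apply: mw.
Qed.

Lemma flat_index_swap k w1 w2 : gauss_word (w1 ++ w2) -> gauss_word (w2 ++ w1) ->
  flat_index f k (w2 ++ w1) = flat_index f k (w1 ++ w2).
Proof.
move=> G G'; have /andP[U _] := G.
have := levelled_level k U; rewrite [RHS]/flat_index; move: (level _ _) => h.
rewrite levelled_cat => /andP[h1 h2].
rewrite (@flat_indexE f k _ h (0 + total_rise k w1)) //.
  by rewrite !index_sum_cat addrC.
by rewrite levelled_cat h2 -addrA -total_rise_cat total_rise_gauss.
Qed.

Lemma flat_index_rot k i w : gauss_word w -> flat_index f k (rot i w) = flat_index f k w.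
Proof.
move=> G; rewrite -[w in RHS](cat_take_drop i); apply: flat_index_swap.
  by rewrite cat_take_drop.
exact: gauss_rotate.
Qed.

Lemma flat_index_relabel k k' w g :
    injective g -> (forall p, p \in w -> k' (g p.1) = k p.1) ->
    gauss_word w -> gauss_word [seq (g p.1, p.2) | p <- w] ->
  flat_index f k' [seq (g p.1, p.2) | p <- w] = flat_index f k w.
Proof.
move=> injg Ek G G'; have /andP[U' _] := G'.
have := levelled_level k' U'; rewrite [LHS]/flat_index; move: (level _ _) => h hw'.
rewrite (@flat_indexE f k w (fun p => h (g p.1, p.2)) 0) //.
  rewrite /index_sum big_map /= big_seq_cond [RHS]big_seq_cond.
  by apply: eq_bigl => p; rewrite /is_virtual /=; case pw: (p \in w); rewrite // Ek.
have: {in w, forall p, rise k' (g p.1, p.2) = rise k p}.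
  by move=> p pw; rewrite /rise /is_virtual /= Ek.
elim: (w) (0 : int) hw' => //= p w' IH x /andP[-> hw'] Er.
rewrite -Er ?mem_head // IH // => q qw; apply: Er; rewrite inE qw orbT //.
Qed.

Lemma same_kinds_virtual w D D' : same_kinds w D D' ->
  forall p, p \in w -> is_virtual (kind D) p = is_virtual (kind D') p.
Proof. by move=> Ek p /Ek; rewrite /is_virtual => ->. Qed.

Theorem flat_index_elementary D D' : elementary_move D D' ->
  flat_index f (kind D) (word D) = flat_index f (kind D') (word D').
Proof.
have gD' := word_gauss D'; have gD := word_gauss D.
case=> -[].
- move=> g injg Ew Ek _; rewrite Ew in gD' *; apply/esym; exact: flat_index_relabel.
- move=> i p q u v _ _ -> /same_kinds_virtual Ek _.
  by rewrite (eq_flat_index _ gD Ek) flat_index_rot.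
- move=> c b w1 w2 Ew Ew' /same_kinds_virtual Ek _;
  rewrite (eq_flat_index _ gD Ek) Ew Ew'.
  by rewrite Ew in gD; rewrite Ew' in gD'; rewrite flat_index_kink.
- move=> a c b r w1 w2 w3 Ew Ew' kc /same_kinds_virtual Ek _.
  rewrite (eq_flat_index _ gD Ek) Ew Ew'.
  by rewrite Ew in gD; rewrite Ew' in gD'; rewrite flat_index_move2.
move=> s t u w1 w2 w3 w4 Ew Ew' tri kin /same_kinds_virtual Ek _.
have perm : perm_eq (word D) (word D').
  by rewrite Ew Ew'; apply: (weave_bwd_perm s t u w1 w2 w3 w4).
rewrite -(@eq_flat_index f (kind D) _ (word D')) // => [|p]; last first.
  by rewrite -(perm_mem perm); apply: Ek.
rewrite Ew Ew'; rewrite Ew in gD; rewrite Ew' in gD'.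
exact: (@flat_index_move3 _ s t u).
Qed.

Theorem flat_index_equivalent D D' : equivalent D D' ->
  flat_index f (kind D) (word D) = flat_index f (kind D') (word D').
Proof. by elim=> [{}D {}D' /flat_index_elementary|||D1 D2 D3 _ -> _]. Qed.

(** The flat index only sees which crossings are real, so crossing changes alone do
    not alter it. *)
Theorem flat_index_changed D D' n :
    changed 0 n D D' -> presents_trivial_knot D' ->
  flat_index f (kind D) (word D) = 0.
Proof.
case=> Ew _ Ek novirt _ [O O0 /flat_index_equivalent E].
transitivity (flat_index f (kind D') (word D')); last first.
  by rewrite -E O0 /flat_index /index_sum big_nil.
rewrite Ew; apply: eq_flat_index => [|p pw]; first exact: word_gauss.
rewrite /is_virtual; have := Ek p pw; case kp: (kind D p.1) => [o|].
  case kp': (kind D' p.1) => [//|] _.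
  (* A real crossing that became virtual would be counted. *)
  suff: (0 < count (fun c => kind D' c == None) (crossings D))%N by rewrite novirt.
  rewrite -has_count; apply/hasP; exists p.1; last by rewrite kp'.
  rewrite mem_filter kp; apply/mapP.
  case: p pw {kp kp'} => c [] cw; first by exists (c, true); rewrite // mem_filter.
  by exists (c, true); rewrite // mem_filter /= -(mate_mem _ (word_gauss D)).
by rewrite !inE /= => /orP[/eqP->|/orP[]/eqP->].
Qed.

End FlatIndex.

(** * Faces of a planar word *)

Section Faces.

Implicit Types (u v : seq passage).

Definition reaches w (x y : dart) : Prop := exists n, iter n (face_step w) x = y.

Lemma reaches_refl w x : reaches w x x.
Proof. by exists 0. Qed.

Lemma reaches_step w x y : reaches w (face_step w x) y -> reaches w x y.
Proof. by case=> n E; exists n.+1; rewrite iterSr. Qed.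

Lemma reaches_trans w x y z : reaches w x y -> reaches w y z -> reaches w x z.
Proof. by case=> m <- [n <-]; exists (n + m); rewrite iterD. Qed.

Definition base_left w : dart := (last (0, true) w, true).

Definition base_right w : dart := (head (0, true) w, false).

Lemma base_mem w : w != [::] -> (base_left w).1 \in w /\ (base_right w).1 \in w.
Proof. by case: w => // a w _; rewrite /= mem_last mem_head. Qed.

(** A certificate that [w] has [K] faces: a labelling of the edge sides that is
    constant along faces, and for each label a side which is reached from all sides
    with this label.  The faces on the two sides of the base edge are distinct and
    come first, because it is along this edge that words are concatenated. *)
Record face_labelling w K (L : dart -> nat) (rep : nat -> dart) : Prop := FaceLabelling {
  label_lt : forall x : dart, x.1 \in w -> L x < K;
  label_step : forall x : dart, x.1 \in w -> L (face_step w x) = L x;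
  label_reach : forall x : dart, x.1 \in w -> reaches w x (rep (L x));
  rep_label : forall i, i < K -> (rep i).1 \in w /\ L (rep i) = i;
  rep_left : rep 0 = base_left w;
  rep_right : rep 1 = base_right w;
  two_faces : 1 < K
}.

Lemma mem_darts w (x : dart) : (x \in darts w) = (x.1 \in w).
Proof.
apply/allpairsPdep/idP => [[p [d [pw _ ->]]] //|xw].
by case: x xw => p d pw; exists p, d; split=> //; case: (d).
Qed.

Lemma face_step_mem w (x : dart) : gauss_word w -> ((face_step w x).1 \in w) = (x.1 \in
  w).
Proof.
move=> G; rewrite /face_step /turn /= mate_mem //.
by case: x.2; rewrite ?mem_next ?mem_prev.
Qed.

Lemma face_step_inj w : gauss_word w -> injective (face_step w).
Proof.
case/andP=> U _ [p d] [p' d'] /=; rewrite /face_step /turn /=.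
set q := if d then _ else _; set q' := if d' then _ else _ => -[Ec Eb E].
have Eq : q = q'.
  by apply: (can_inj mateK); rewrite /mate Ec Eb.
have Ed : d = d' by move: E; rewrite Eq; case: (q'.2); case: (d); case: (d').
move: Eq; rewrite /q /q' -Ed; case: (d).
  by move/(can_inj (prev_next U))->.
by move/(can_inj (next_prev U))->.
Qed.

(** The orbits of the injective map [face_step] are its connected components, and
    the labels are in bijection with them. *)
Lemma nb_facesP w K L rep : gauss_word w -> face_labelling w K L rep -> nb_faces w = K.
Proof.
move=> G F.
have step_in (x : seq_sub (darts w)) : face_step w (val x) \in darts w.
  by rewrite mem_darts face_step_mem // -mem_darts (valP x).
pose f x : seq_sub (darts w) := Sub (face_step w (val x)) (step_in x).
have injf : injective f.
  by move=> x y /(congr1 val) /= /(face_step_inj G) /val_inj.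
have symf := fconnect_sym injf.
have -> : nb_faces w = fcard f predT.
  rewrite /nb_faces; apply: eq_n_comp; apply: eq_connect => x y.
  by rewrite /= -val_eqE.
have iter_val n x : val (iter n f x) = iter n (face_step w) (val x).
  by elim: n => //= n ->.
have L_iter n x : L (val (iter n f x)) = L (val x).
  elim: n => //= n <-; apply: label_step F _ _.
  by rewrite -mem_darts (valP (iter n f x)).
have rep_in (i : 'I_K) : rep i \in darts w.
  by rewrite mem_darts; have [] := rep_label F (ltn_ord i).
pose g (i : 'I_K) : seq_sub (darts w) := froot f (Sub (rep i) (rep_in i)).
have L_root x : L (val (froot f x)) = L (val x).
  by have /iter_findex <- := connect_root (frel f) x; rewrite L_iter.
have L_g i : L (val (g i)) = i.
  by rewrite L_root /=; have [] := rep_label F (ltn_ord i).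
have injg : injective g by move=> i j E; apply: ord_inj; rewrite -!L_g E.
rewrite -[RHS]card_ord -(card_codom injg) /n_comp_mem; apply: eq_card => x.
rewrite !inE andbT; apply/idP/codomP => [/eqP rx|[i ->]]; last exact: roots_root.
have xw : (val x).1 \in w by rewrite -mem_darts (valP x).
exists (Ordinal (label_lt F xw)); rewrite -[LHS]rx; apply/(fingraph.rootP symf).
have [n E] := label_reach F xw.
apply/connectP; exists (traject f (f x) n); first exact: fpath_traject.
by apply: val_inj; rewrite last_traject iter_val E.
Qed.

(** * Connected sums of planar words *)

Lemma next_cat u v p : uniq (u ++ v) -> p \in u -> v != [::] ->
  next (u ++ v) p = if p == last (0, true) u then head (0, true) v else next u p.
Proof.
case: u => // y u U pu; case: v U => // z v U _.
rewrite !next_nth mem_cat pu index_cat pu.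
have Uu : uniq (y :: u) by move: U; rewrite cat_uniq => /andP[].
have lastE : (p == last y u) = (index p (y :: u) == size u).
  apply/eqP/eqP => [->|E]; first by rewrite index_last.
  by rewrite -(nth_index y pu) E nth_last.
have lei : index p (y :: u) <= size u by rewrite -ltnS -[(size u).+1]/(size (y :: u))
  index_mem.
rewrite [last _ _]/= lastE; move: (index p _) lei => i lei /=.
rewrite nth_cat; case: ltngtP lei => // -> _.
by rewrite subnn.
Qed.

Lemma prev_cat u v p : uniq (u ++ v) -> p \in u -> v != [::] ->
  prev (u ++ v) p = if p == head (0, true) u then last (0, true) v else prev u p.
Proof.
move=> U pu v0; have /and3P[Uu disj Uv] : [&& uniq u, ~~ has (mem u) v & uniq v].
  by rewrite -cat_uniq.
have next_last w : w != [::] -> uniq w -> next w (last (0, true) w) = head (0, true) w.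
  by case: w => // a w _ Uw;
    rewrite next_nth [last _ _]/= mem_last index_last // nth_default.
have u0 : u != [::] by case: (u) pu.
have Uvu : uniq (v ++ u) by rewrite uniq_catC.
have swap q : next (u ++ v) q = next (v ++ u) q by rewrite -(next_rot (size u))
  ?rot_size_cat.
apply: (can_inj (prev_next U)); rewrite next_prev //.
case: eqP => [->|/eqP ph].
  by have [lv _] := base_mem v0; rewrite swap next_cat ?eqxx.
rewrite next_cat ?mem_prev // next_prev //; case: eqP => // E.
by rewrite -[p in p != _](next_prev Uu) E next_last ?eqxx in ph.
Qed.

(** Concatenation exchanges the continuations of the two walks along each side of
    the base edges; nothing else changes. *)
Lemma face_step_cat u v (x : dart) : uniq (u ++ v) -> v != [::] -> x.1 \in u ->
  face_step (u ++ v) x =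
    if x == base_left u then face_step v (base_left v)
    else if x == base_right u then face_step v (base_right v) else face_step u x.
Proof.
move=> U v0; case: x => p d /= pu.
have Uv : uniq v by move: U; rewrite cat_uniq => /and3P[].
have next_last : next v (last (0, true) v) = head (0, true) v.
  by case: (v) v0 Uv => // a w _ Uw;
    rewrite next_nth [last _ _]/= mem_last index_last // nth_default.
rewrite /face_step /base_left /base_right !xpair_eqE /=.
case: d; rewrite ?andbF ?andbT /= ?next_cat ?prev_cat //; case: eqP => //= _.
  by rewrite next_last.
by rewrite -next_last prev_next.
Qed.

(** A walk in [u] that stops as soon as it meets its representative never uses the
    base edge before, since the sides of that edge are themselves
    representatives. *)
Lemma lift_reach u v K L rep (x : dart) :
    gauss_word u -> uniq (u ++ v) -> v != [::] -> face_labelling u K L rep ->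
    x.1 \in u -> reaches (u ++ v) x (rep (L x)).
Proof.
move=> G U v0 F; have u0 : u != [::] -> True by [].
move=> xu; have [n] := label_reach F xu; elim: n x xu => [|n IH] x xu E.
  by rewrite -E; apply: reaches_refl.
have [<-|xrep] := eqVneq x (rep (L x)); first exact: reaches_refl.
apply: reaches_step; rewrite face_step_cat //.
have [Bl Br] : (base_left u).1 \in u /\ (base_right u).1 \in u.
  by apply: base_mem; case: (u) xu.
have l0 : L (base_left u) = 0.
  by rewrite -(rep_left F); have [] := rep_label F (ltnW (two_faces F)).
have l1 : L (base_right u) = 1.
  by rewrite -(rep_right F); have [] := rep_label F (two_faces F).
case: eqP => [Ex|_]; first by rewrite Ex l0 (rep_left F) eqxx in xrep.
case: eqP => [Ex|_]; first by rewrite Ex l1 (rep_right F) eqxx in xrep.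
rewrite -(label_step F xu); apply: IH; first by rewrite face_step_mem.
by rewrite -iterSr (label_step F xu).
Qed.

(** The labels [0] and [1] of the two words are identified, and the other labels of
    the second word are moved past those of the first. *)
Definition cat_label u K (Lu Lv : dart -> nat) (x : dart) : nat :=
  if x.1 \in u then Lu x else if Lv x < 2 then Lv x else Lv x + (K - 2).

(** After concatenation the base edge starts at the last passage of [v] and ends at
    the first one of [u]. *)
Definition cat_rep K (ru rv : nat -> dart) i : dart :=
  if i == 0 then rv 0 else if i < K then ru i else rv (i - (K - 2)).

Lemma face_labelling_cat u v Ku Kv Lu Lv ru rv :
    gauss_word u -> gauss_word v -> uniq (u ++ v) ->
    face_labelling u Ku Lu ru -> face_labelling v Kv Lv rv ->
  face_labelling (u ++ v) (Ku + Kv - 2) (cat_label u Ku Lu Lv) (cat_rep Ku ru rv).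
Proof.
move=> Gu Gv U Fu Fv.
have Ku2 := two_faces Fu; have Kv2 := two_faces Fv.
have [ru0 Lu0] := rep_label Fu (ltnW Ku2); have [ru1 Lu1] := rep_label Fu Ku2.
have [rv0 Lv0] := rep_label Fv (ltnW Kv2); have [rv1 Lv1] := rep_label Fv Kv2.
have u0 : u != [::] by case: (u) ru0.
have v0 : v != [::] by case: (v) rv0.
have Uvu : uniq (v ++ u) by rewrite uniq_catC.
have notu p : p \in v -> (p \in u) = false.
  move=> pv; apply/negP=> pu; move: U; rewrite cat_uniq => /and3P[_ /hasPn/(_ p pv)].
  by rewrite /= pu.
(* The word [v ++ u] has the same faces, so that what is shown for [u] holds for
   [v] as well. *)
have swap x : face_step (u ++ v) x = face_step (v ++ u) x.
  rewrite /face_step -(rot_size_cat u v) next_rot //.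
  case: x.2 => //; congr turn.
  by apply: (can_inj (prev_next U));
    rewrite next_prev // -(next_rot (size u)) // rot_size_cat next_prev.
have stepu x : x.1 \in u -> x != ru 0 -> x != ru 1 -> face_step (u ++ v) x = face_step u
  x.
  by rewrite (rep_left Fu) (rep_right Fu) => xu /negPf x0 /negPf x1;
    rewrite face_step_cat // x0 x1.
have stepv x : x.1 \in v -> x != rv 0 -> x != rv 1 -> face_step (u ++ v) x = face_step v
  x.
  by rewrite (rep_left Fv) (rep_right Fv) swap => xv /negPf x0 /negPf x1;
    rewrite face_step_cat // x0 x1.
have ru01 : ru 1 != ru 0 by apply/eqP=> E; move: Lu1; rewrite E Lu0.
have rv01 : rv 1 != rv 0 by apply/eqP=> E; move: Lv1; rewrite E Lv0.
have stepu0 : face_step (u ++ v) (ru 0) = face_step v (rv 0).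
  by rewrite (rep_left Fv) (rep_left Fu) face_step_cat ?eqxx // -(rep_left Fu).
have stepu1 : face_step (u ++ v) (ru 1) = face_step v (rv 1).
  rewrite face_step_cat // -(rep_left Fu) -(rep_right Fu) (negPf ru01) eqxx.
  by rewrite (rep_right Fv).
have stepv0 : face_step (u ++ v) (rv 0) = face_step u (ru 0).
  by rewrite swap (rep_left Fv) (rep_left Fu) face_step_cat ?eqxx // -(rep_left Fv).
have stepv1 : face_step (u ++ v) (rv 1) = face_step u (ru 1).
  rewrite swap face_step_cat // -(rep_left Fv) -(rep_right Fv) (negPf rv01) eqxx.
  by rewrite (rep_right Fu).
have Lcu x : x.1 \in u -> cat_label u Ku Lu Lv x = Lu x by rewrite /cat_label => ->.
have Lcv x : x.1 \in v -> cat_label u Ku Lu Lv x =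
    if Lv x < 2 then Lv x else Lv x + (Ku - 2).
  by move=> xv; rewrite /cat_label notu.
have reachu x : x.1 \in u -> reaches (u ++ v) x (ru (Lu x)) by exact: (lift_reach Gu U
  v0 Fu).
have reachv x : x.1 \in v -> reaches (u ++ v) x (rv (Lv x)).
  move=> xv; have [n E] := lift_reach Gv Uvu u0 Fv xv; exists n; rewrite -E.
  exact: (eq_iter swap).
split.
- move=> x; rewrite mem_cat => /orP[xu|xv].
    by rewrite Lcu //; move: (label_lt Fu xu) Kv2; clear; lia.
  by rewrite Lcv //; move: (label_lt Fv xv) Ku2; clear; case: ifP; lia.
- move=> x; rewrite mem_cat => /orP[xu|xv].
    rewrite [RHS]Lcu //; have [->|x0] := eqVneq x (ru 0).
      by rewrite stepu0 Lcv ?face_step_mem // (label_step Fv rv0) Lv0 Lu0.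
    have [->|x1] := eqVneq x (ru 1).
      by rewrite stepu1 Lcv ?face_step_mem // (label_step Fv rv1) Lv1 Lu1.
    by rewrite stepu // Lcu ?face_step_mem // (label_step Fu).
  rewrite [RHS]Lcv //; have [->|x0] := eqVneq x (rv 0).
    by rewrite stepv0 Lcu ?face_step_mem // (label_step Fu ru0) Lv0 Lu0.
  have [->|x1] := eqVneq x (rv 1).
    by rewrite stepv1 Lcu ?face_step_mem // (label_step Fu ru1) Lv1 Lu1.
  by rewrite stepv // Lcv ?face_step_mem // (label_step Fv).
- move=> x; rewrite mem_cat => /orP[xu|xv].
    rewrite Lcu //; apply: reaches_trans (reachu x xu) _.
    have := label_lt Fu xu; rewrite /cat_rep; case: (Lu x) => [_|l ->]; last first.
      exact: reaches_refl.
    apply: reaches_step; rewrite stepu0; have := reachv (face_step v (rv 0)).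
    by rewrite face_step_mem // (label_step Fv rv0) Lv0; apply.
  rewrite Lcv //; apply: reaches_trans (reachv x xv) _.
  case: (Lv x) => [|[|l]] /=; first exact: reaches_refl.
    rewrite /cat_rep /= Ku2; apply: reaches_step; rewrite stepv1.
    by have := reachu (face_step u (ru 1));
      rewrite face_step_mem // (label_step Fu ru1) Lu1; apply.
  rewrite /cat_rep addSn /= addSn ltnNge -addSn -addSn.
  rewrite (_ : Ku <= l.+2 + (Ku - 2)); last by clear; lia.
  rewrite addnK.
  exact: reaches_refl.
- case=> [|i] lti; rewrite /cat_rep /=; first by rewrite mem_cat rv0 orbT Lcv // Lv0.
  case: ifP => [iu|iu].
    by have [iu1 iu2] := rep_label Fu iu; rewrite mem_cat iu1 Lcu.
  have iv : i.+1 - (Ku - 2) < Kv by move: lti iu Ku2; clear; lia.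
  have [iv1 iv2] := rep_label Fv iv; rewrite mem_cat iv1 orbT Lcv // iv2; split=> //.
  by rewrite ifF; move: iu Ku2; clear; lia.
- rewrite /cat_rep /= (rep_left Fv) /base_left last_cat.
  by case: (v) v0.
- rewrite /cat_rep /= Ku2 (rep_right Fu) /base_right.
  by case: (u) u0.
by move: Ku2 Kv2; clear; lia.
Qed.

(** Words that may be concatenated: as two faces are lost each time, so that
    [(K + K' - 2)] faces remain, Euler's count is preserved; the size is even
    because [./2] has to be additive. *)
Definition cellular w : Prop :=
  [/\ gauss_word w, ~~ odd (size w) &
      exists L rep, face_labelling w ((size w)./2 + 2) L rep].

Lemma cellular_planar w : cellular w -> planar w.
Proof.
by case=> G _ [L [rep F]]; rewrite /planar (nb_facesP G F) eqxx orbT.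
Qed.

Lemma gauss_cat u v :
  gauss_word u -> gauss_word v -> uniq (u ++ v) -> gauss_word (u ++ v).
Proof.
move=> /andP[_ /allP mu] /andP[_ /allP mv] U; rewrite /gauss_word U; apply/allP=> p.
by rewrite !mem_cat => /orP[/mu|/mv] ->; rewrite ?orbT.
Qed.

Lemma cellular_cat u v : cellular u -> cellular v -> uniq (u ++ v) -> cellular (u ++ v).
Proof.
case=> Gu eu [Lu [ru Fu]] [Gv ev [Lv [rv Fv]]] U; split.
- exact: gauss_cat.
- by rewrite size_cat oddD negb_add (negPf eu) (negPf ev).
have -> : (size (u ++ v))./2 + 2 = ((size u)./2 + 2) + ((size v)./2 + 2) - 2.
  by rewrite size_cat halfD (negPf eu); move: (size u) (size v); clear; lia.
by eexists; eexists; exact: (face_labelling_cat Gu Gv U Fu Fv).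
Qed.

Definition shift_passage c (p : passage) : passage := (p.1 + c, p.2).

Definition shift_word c w : seq passage := [seq shift_passage c p | p <- w].

Lemma shift_inj c : injective (shift_passage c).
Proof. by move=> [a b] [a' b'] [] /addIn-> ->. Qed.

Lemma gauss_shift c w : gauss_word w -> gauss_word (shift_word c w).
Proof.
case/andP=> U /allP mw; rewrite /gauss_word (map_inj_uniq (@shift_inj c)) U.
apply/allP=> _ /mapP[p /mw mp ->]; apply/mapP; by exists (mate p).
Qed.

Definition shift_dart c (x : dart) : dart := (shift_passage c x.1, x.2).

Lemma face_step_shift c w x : uniq w ->
  face_step (shift_word c w) (shift_dart c x) = shift_dart c (face_step w x).
Proof.
move=> U; rewrite /face_step /turn /= (next_map (@shift_inj c)) //.
by rewrite (prev_map (@shift_inj c)) //; case: x.2.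
Qed.

Lemma face_labelling_shift c w K L rep :
    uniq w -> face_labelling w K L rep ->
  face_labelling (shift_word c w) K
    (fun x => L ((x.1.1 - c, x.1.2), x.2)) (shift_dart c \o rep).
Proof.
move=> U F.
have unshift (x : dart) : x.1 \in shift_word c w ->
    exists2 y : dart, y.1 \in w & x = shift_dart c y.
  by case: x => q d /= /mapP[p pw ->]; exists (p, d).
have K0 := ltnW (two_faces F); have w0 : w != [::].
  by have [] := rep_label F K0; case: (w).
have LE (y : dart) : L (((shift_dart c y).1.1 - c, (shift_dart c y).1.2), (shift_dart c
  y).2) = L y.
  by rewrite /= addnK; case: y => [[]].
split.
- by move=> _ /unshift[y yw ->]; rewrite LE; apply: label_lt F _ _.
- by move=> _ /unshift[y yw ->]; rewrite face_step_shift // !LE; apply: label_step F _ _.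
- move=> _ /unshift[y yw ->]; rewrite LE; have [n E] := label_reach F yw.
  exists n; rewrite /= -E; elim: (n) => //= m ->; exact: face_step_shift.
- move=> i lti; have [iw il] := rep_label F lti; split; last by rewrite LE.
  exact: map_f.
- rewrite /= (rep_left F) /base_left /shift_dart /=.
  by case: (w) w0 => //= a w' _; rewrite last_map.
- by rewrite /= (rep_right F) /base_right /shift_dart /=; case: (w) w0.
exact: two_faces F.
Qed.

Lemma cellular_shift c w : cellular w -> cellular (shift_word c w).
Proof.
case=> G ew [L [rep F]]; split; first exact: gauss_shift.
  by rewrite size_map.
rewrite size_map; eexists; eexists; apply: face_labelling_shift F.
by case/andP: G.
Qed.

(** A face has at most as many sides as there are darts, so this list goes all the
    way around the face of [x]. *)
Definition face_orbit w (x : dart) : seq dart := traject (face_step w) x (size (darts w)).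

Definition face_of w (reps : seq dart) (x : dart) : nat :=
  find (fun r => r \in face_orbit w x) reps.

(** One side of each face, those of the base edge first. *)
Definition face_reps w : seq dart :=
  foldl (fun reps x => if has (fun r => r \in face_orbit w x) reps then reps else rcons
    reps x)
    [:: base_left w; base_right w] (darts w).

(** A computation that builds the certificate [face_labelling] and checks it. *)
Definition cellular_check w : bool :=
  let reps := face_reps w in
  [&& gauss_word w, ~~ odd (size w), size reps == (size w)./2 + 2,
      all (fun x => face_of w reps (face_step w x) == face_of w reps x) (darts w),
      all (fun x => face_of w reps x < size reps) (darts w),
      all (fun i => (nth (base_left w) reps i \in darts w) &&
                    (face_of w reps (nth (base_left w) reps i) == i)) (iota 0 (size
                      reps)),
      nth (base_left w) reps 0 == base_left w &
      nth (base_left w) reps 1 == base_right w].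

Lemma cellular_checkP w : cellular_check w -> cellular w.
Proof.
case/and5P=> G ew /eqP sz /allP st /and4P[/allP lt /allP rp /eqP r0 /eqP r1].
split=> //; exists (face_of w (face_reps w)), (nth (base_left w) (face_reps w)).
rewrite -sz; split=> //.
- by move=> x xw; apply: lt; rewrite mem_darts.
- by move=> x xw; apply/eqP/st; rewrite mem_darts.
- move=> x xw; have := lt x; rewrite mem_darts => /(_ xw); rewrite -has_find => h.
  have := nth_find (base_left w) h; case/trajectP=> n _ ->; by exists n.
- move=> i lti; have := rp i; rewrite mem_iota lti => /(_ isT) /andP[].
  by rewrite mem_darts => -> /eqP->.
by rewrite sz addn2.
Qed.

End Faces.

(** * The knots and their unknotting *)

(** The crossings [1] and [3] will be virtual.  The base edge is chosen outside of
    the clasps that [unknotted_core] undoes. *)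
Definition core := [:: (1, false); (2, true); (0, false); (3, false); (4, true);
  (1, true);
 (2, false); (5, false); (3, true); (4, false); (5, true); (0, true)].

Definition trefoil := [:: (0, true); (1, false); (2, true); (0, false); (1, true);
  (2, false)].

Definition trefoil_label (m : nat) : nat := (6 + 3 * m).

Fixpoint knot_word (n : nat) : seq passage :=
  if n is m.+1 then knot_word m ++ shift_word (trefoil_label m) trefoil else core.

(** The list is for the core; by default crossings are positive, which makes the
    trefoils alternating. *)
Definition knot_kind (c : nat) : option bool :=
  nth (Some true) [:: Some true; None; Some false; None; Some true; Some true] c.

(** In the core, the crossing [4] has become virtual.  The labels of each trefoil
    start at a multiple of [3], so its first crossing is the one that is switched. *)
Definition unknot_kind (c : nat) : option bool :=
  nth (Some (c %% 3 != 0))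
      [:: Some true; None; Some false; None; None; Some true] c.

Lemma knot_labels n p : p \in knot_word n -> (p.1 < trefoil_label n).
Proof.
elim: n => [|n IH]; first by move: p; apply/allP; vm_compute.
rewrite mem_cat => /orP[/IH|/mapP[q qw ->]].
  by rewrite /trefoil_label; lia.
have q3 : (q.1 < 3) by move: q qw; apply/allP; vm_compute.
by rewrite [_.1]/= /trefoil_label mulnS [leqRHS]addnCA ltn_add2r.
Qed.

Lemma append_uniq n w m : uniq w -> (trefoil_label n <= m) ->
  uniq (knot_word n) -> uniq (knot_word n ++ shift_word m w).
Proof.
move=> Uw le U; rewrite cat_uniq U (map_inj_uniq (@shift_inj m)) Uw andbT.
apply/hasPn=> _ /mapP[q qw ->]; apply/negP=> /knot_labels.
by rewrite ltnNge (leq_trans le) ?leq_addl.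
Qed.

Lemma append_cellular n w m : cellular w -> (trefoil_label n <= m) ->
  cellular (knot_word n) -> cellular (knot_word n ++ shift_word m w).
Proof.
move=> tw le tn; apply: cellular_cat => //; first exact: cellular_shift.
by case: tw tn => /andP[U _] _ _ [/andP[Un _] _ _]; apply: append_uniq.
Qed.

Lemma knot_cellular n : cellular (knot_word n).
Proof.
elim: n => [|n IH]; first by apply: cellular_checkP; vm_compute.
apply: append_cellular => //.
by apply: cellular_checkP; vm_compute.
Qed.

Lemma unknot_kind_trefoil m i : (i < 3) -> unknot_kind (i + trefoil_label m) = Some (i
  != 0).
Proof.
move=> i3; rewrite /unknot_kind nth_default; last by rewrite /trefoil_label /=; lia.
by congr Some; rewrite /trefoil_label; case: i i3 => [|[|[|]]] // _; lia.
Qed.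

Lemma knot_kind_trefoil m i : knot_kind (i + trefoil_label m) = Some true.
Proof. by rewrite /knot_kind nth_default // /trefoil_label /=; lia. Qed.

Definition drawable w : Prop := gauss_word w /\ planar w.

Lemma cellular_drawable w : cellular w -> drawable w.
Proof. by move=> tw; split; [case: tw | apply: cellular_planar]. Qed.

Definition draw (k : nat -> option bool) w (dw : drawable w) : diagram :=
  @Diagram w k true dw.1 dw.2.

Lemma crossings_draw k w (dw : drawable w) :
  crossings (draw k dw) = [seq c <- [seq p.1 | p <- w & p.2] | k c != None].
Proof. by []. Qed.

Lemma knot_counts n (dw : drawable (knot_word n)) :
  count (fun c => unknot_kind c == None) (crossings (draw knot_kind dw)) = 1 /\
  count (fun c => unknot_kind c == omap negb (knot_kind c))
    (crossings (draw knot_kind dw)) = n.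
Proof.
rewrite crossings_draw {dw}; elim: n => [|n [IH1 IH2]]; first by vm_compute.
rewrite [knot_word _]/= filter_cat map_cat filter_cat !count_cat IH1 IH2.
by rewrite /= !knot_kind_trefoil /= !unknot_kind_trefoil // !knot_kind_trefoil /= addn0
  addn1.
Qed.

Lemma knot_changed n (dw dw' : drawable (knot_word n)) :
  changed 1 n (draw knot_kind dw) (draw unknot_kind dw').
Proof.
have [E1 E2] := knot_counts dw; split=> //= p pw.
rewrite !inE /knot_kind /unknot_kind; case: (p.1) => [|[|[|[|[|[|c]]]]]] //=.
by rewrite nth_nil nth_nil; case: (_ != _).
Qed.

(** Quantified over all diagrams with the given word because a word determines its
    diagram only up to the proofs that the diagram contains. *)
Definition unknotted w : Prop :=
  forall D, word D = w -> kind D = unknot_kind -> outer_left D = true ->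
    presents_trivial_knot D.

Lemma trivial_equivalent D D' :
  equivalent D D' -> presents_trivial_knot D -> presents_trivial_knot D'.
Proof.
by move=> DD' [O O0 OD]; exists O => //; apply: rst_trans OD DD'.
Qed.

Lemma unknotted_nil : unknotted [::].
Proof. by move=> D D0 _ _; exists D => //; apply: rst_refl. Qed.

Lemma unknotted_move w w' (dw : drawable w) :
    (forall D D', word D = w -> word D' = w' -> kind D = kind D' ->
       kind D' = unknot_kind -> outer_left D' = outer_left D -> elementary_move D D') ->
  unknotted w -> unknotted w'.
Proof.
move=> move U D' Ew' Ek Eo.
pose D := draw unknot_kind dw.
apply: (@trivial_equivalent D); last exact: U.
by apply/rst_step/move.
Qed.

Lemma unknotted_kink c b w1 w2 : drawable (w1 ++ w2) -> unknotted (w1 ++ w2) ->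
  unknotted (w1 ++ [:: (c, b); (c, ~~ b)] ++ w2).
Proof.
move=> dw; apply: (unknotted_move dw) => D D' Ew Ew' Ek _ Eo.
apply: EMove1; apply: (@Move1 D D' c b w1 w2) => // p _; by rewrite Ek.
Qed.

Lemma unknotted_bigon a c b w1 w2 w3 :
    unknot_kind c = omap negb (unknot_kind a) ->
    drawable (w1 ++ w2 ++ w3) -> unknotted (w1 ++ w2 ++ w3) ->
  unknotted (w1 ++ [:: (a, b); (c, ~~ b)] ++ w2 ++ [:: (a, ~~ b); (c, b)] ++ w3).
Proof.
move=> Ec tw; apply: (unknotted_move tw) => D D' Ew Ew' Ek Ek' Eo.
apply: EMove2; apply: (@Move2 D D' a c b false w1 w2 w3) => //.
  by rewrite Ek'.
by move=> p _; rewrite Ek.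
Qed.

(** The crossings [3] and [4], now both virtual, form a clasp.  Once it is undone,
    [5] becomes a kink; after its removal the real crossings [2] and [0] form a
    clasp, and the kink [1] remains. *)
Lemma unknotted_core : unknotted core.
Proof.
apply: (@unknotted_bigon 3 4 false [:: (1, false); (2, true); (0, false)]
  [:: (1, true); (2, false); (5, false)] [:: (5, true); (0, true)]) => //.
  by apply/cellular_drawable/cellular_checkP; vm_compute.
apply: (@unknotted_kink 5 false [:: (1, false); (2, true); (0, false);
  (1, true); (2, false)] [:: (0, true)]).
  by apply/cellular_drawable/cellular_checkP; vm_compute.
apply: (@unknotted_bigon 2 0 true [:: (1, false)] [:: (1, true)] [::]) => //.
  by apply/cellular_drawable/cellular_checkP; vm_compute.
apply: (@unknotted_kink 1 false [::] [::]).
  by [].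
exact: unknotted_nil.
Qed.

(** With the first crossing switched, the first two crossings of a trefoil form a
    clasp, and undoing it leaves a kink. *)
Lemma unknotted_knot n : unknotted (knot_word n).
Proof.
elim: n => [|n IH]; first exact: unknotted_core.
set c := trefoil_label n.
have tk := append_cellular (w := [:: (2, true); (2, false)]) (n := n) (m := c).
apply: (@unknotted_bigon (0 + c) (1 + c) true (knot_word n)
  [:: (2 + c, true)] [:: (2 + c, false)]).
- by rewrite !unknot_kind_trefoil.
- apply/cellular_drawable/tk => //; last exact: knot_cellular.
  by apply: cellular_checkP; vm_compute.
rewrite -[_ ++ _ ++ _]/(knot_word n ++ [:: (2 + c, true); (2 + c, ~~ true)] ++ [::]).
apply: unknotted_kink; rewrite cats0 //; exact/cellular_drawable/knot_cellular.
Qed.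

(** * The invariants of the knots *)

Fixpoint colour_type (n : nat) : finType :=
  if n is m.+1 then (colour_type m * 'F_3)%type else ('F_3 * 'F_3)%type.

Lemma card_F3 : #|'F_3| = 3.
Proof. by rewrite card_ord. Qed.

Lemma card_colour_type n : #|colour_type n| = (3 ^ n.+2).
Proof.
elim: n => [|n IH]; first by rewrite card_prod card_F3.
by rewrite [colour_type _]/= card_prod IH card_F3 -expnSr.
Qed.

Section Invariants.

Local Open Scope ring_scope.

Lemma F3_triple (x : 'F_3) : x + x + x = 0.
Proof. by apply/val_inj; case: x => [[|[|[|]]]]. Qed.

(** The free colours are those of the base edge and of the over arc common to the
    crossings [2] and [4]. *)
Lemma core_many : many_colourings 'F_3 ('F_3 * 'F_3)%type knot_kind core.
Proof.
pose y (st : 'F_3 * 'F_3) (c : nat) := if c \in [:: 2; 4]%N then st.2 else st.1.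
exists (fun st => (y st, st.1)); split=> [[s t]|[s t] [s' t'] [/= Es Ey]].
  rewrite /coloured /walk /= /pass /is_over /is_under /y /=.
  have E1 : s + s - (t + t - s) = t.
    by rewrite -[LHS]addr0 -(F3_triple (t - s)); ring.
  have E2 : t + t - (s + s - t) = s.
    by rewrite -[LHS]addr0 -(F3_triple (s - t)); ring.
  by rewrite E1 E2 !eqxx.
by rewrite Es; congr pair; apply: (Ey (2, true)).
Qed.

(** The summand can be coloured with any colour [t] on its second over arc, and it
    returns the strand with the colour it came with; both rely on [3 = 0]. *)
Lemma many_trefoil T w c :
    many_colourings 'F_3 T knot_kind w ->
    (forall i, (i < 3)%N -> knot_kind (i + c) = Some true) ->
    (forall p, p \in w -> (p.1 < c)%N) ->
  many_colourings 'F_3 (T * 'F_3)%type knot_kind (w ++ shift_word c trefoil).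
Proof.
case=> phi [col inj] kc fresh.
pose y (it : T * 'F_3) d : 'F_3 :=
  let s := (phi it.1).2 in
  if (d < c)%N then (phi it.1).1 d else nth 0 [:: s; it.2; it.2 + it.2 - s] (d - c).
have yc it i : y it (i + c)%N =
    nth 0 [:: (phi it.1).2; it.2; it.2 + it.2 - (phi it.1).2] i.
  by rewrite /y ltnNge leq_addl addnK.
have yw it p : p \in w -> y it p.1 = (phi it.1).1 p.1.
  by move/fresh; rewrite /y => ->.
exists (fun it => (y it, (phi it.1).2)); split=> [it|it it' [/= Es Ey]].
  have := col it.1; rewrite /coloured /= over_ok_cat walk_cat.
  rewrite (@eq_walk _ knot_kind knot_kind (y it) (phi it.1).1) //;
    last by move=> p /(yw it).
  rewrite (@eq_over_ok _ knot_kind knot_kind (y it) (phi it.1).1) //;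
    last by move=> p /(yw it).
  case/andP=> -> /eqP ->.
  rewrite /walk /= /pass /is_over /is_under /= !kc // !yc /=.
  set s := (phi it.1).2; set t := it.2.
  have E1 : s + s - (t + t - s) = t.
    by rewrite -[LHS]addr0 -(F3_triple (t - s)); ring.
  have E2 : t + t - s + (t + t - s) - t = s.
    by rewrite -[LHS]addr0 -(F3_triple (s - t)); ring.
  by rewrite E1 E2 !eqxx.
have E1 : it.1 = it'.1.
  apply: inj; split=> // p pw kp; have := Ey p; rewrite mem_cat pw !yw //; exact.
have := Ey (1 + c, false)%N; rewrite mem_cat /= !yc kc //= => E2.
rewrite [it]surjective_pairing [it']surjective_pairing E1; congr pair.
by apply: E2; rewrite // !inE eqxx !orbT.
Qed.

Lemma knot_many n : many_colourings 'F_3 (colour_type n) knot_kind (knot_word n).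
Proof.
elim: n => [|n IH]; first exact: core_many.
apply: many_trefoil => //; last exact: knot_labels.
by move=> i _; apply: knot_kind_trefoil.
Qed.

(** With this [f], the flat index is a coefficient of Turaev's u-polynomial, up to
    conventions. *)
Definition unit_index (x : int) : int := (x == 1)%:Z - (x == -1)%:Z.

Lemma unit_index_odd x : unit_index (- x) = - unit_index x.
Proof. by rewrite /unit_index eqr_oppLR -[- x == -1]eqr_opp !opprK opprB. Qed.

(** The real crossings of the core have the indices [0], [-2], [1] and [1]. *)
Lemma core_flat_index : flat_index unit_index knot_kind core = 2.
Proof. by rewrite /flat_index /index_sum unlock; vm_compute. Qed.

(** All crossings of a trefoil have index [0]. *)
Lemma flat_index_trefoil k w c :
    (forall i, (i < 3)%N -> k (i + c)%N = Some true) ->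
    gauss_word w -> gauss_word (w ++ shift_word c trefoil) ->
  flat_index unit_index k (w ++ shift_word c trefoil) = flat_index unit_index k w.
Proof.
move=> kc G G'; have /andP[U' _] := G'.
have := levelled_level k U'; rewrite [LHS]/flat_index; move: (level _ _) => h.
rewrite levelled_cat => /andP[hw hc].
rewrite index_sum_cat (flat_indexE unit_index G hw).
suff -> : index_sum unit_index k h (shift_word c trefoil) = 0 by rewrite addr0.
move: hc; rewrite /= /rise /is_virtual /index_sum !big_cons big_nil /= !kc //=.
case/and5P=> /eqP E1 /eqP E2 /eqP E3 /eqP E4 /and3P[/eqP E5 /eqP E6 _].
have real i : (i < 3)%N -> is_virtual k (shift_passage c (i, true)) = false.
  by move=> i3; rewrite /is_virtual kc.
have zero i : (i < 3)%N ->
    h (shift_passage c (i, false)) = h (shift_passage c (i, true)) + 1 ->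
    unit_index (h (mate (shift_passage c (i, true))) -
      h (shift_passage c (i, true)) - 1) = 0.
  by move=> _ E; rewrite [mate _]/(shift_passage c (i, false)) E addrAC addrK subrr.
rewrite !real //= !zero ?addr0 // ?E1 ?E2 ?E3 ?E4 ?E5 ?E6; ring.
Qed.

Lemma knot_flat_index n : flat_index unit_index knot_kind (knot_word n) = 2.
Proof.
elim: n => [|n IH]; first exact: core_flat_index.
rewrite flat_index_trefoil //.
- by move=> i _; apply: knot_kind_trefoil.
- by have [] := knot_cellular n.
by have [] := knot_cellular n.+1.
Qed.

End Invariants.

Theorem theorem5p5 (n : nat) :
  exists K : virtual_knot, unknotting_index K (1, n).
Proof.
have dn := cellular_drawable (knot_cellular n).
pose D := draw knot_kind dn.
have unknot_1n : unknottable D (1, n).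
  exists (draw unknot_kind dn); first exact: knot_changed.
  exact: unknotted_knot.
have lower D' (mn : nat *l nat) : equivalent D D' -> unknottable D' mn ->
    (((1, n) : nat *l nat) <= mn)%O.
  case: mn => a b DD' [D1 ch triv].
  have bound := changed_bound ch triv ((many_equivalent 'F_3 (colour_type n) DD').1
    (knot_many n)).
  move: bound; rewrite card_colour_type card_F3 leq_exp2l // ltnS /= => bound.
  (* Crossing changes alone would preserve the flat index. *)
  have a0 : a != 0.
    apply/eqP=> a0; rewrite a0 in ch.
    have := flat_index_changed unit_index_odd ch triv.
    rewrite -(flat_index_equivalent unit_index_odd DD').
    by rewrite /= knot_flat_index.
  change ((1 <= a) && ((a <= 1) ==> (n <= b))).
  rewrite lt0n a0; apply/implyP=> a1.
  by move: bound; rewrite (_ : a = 1) //; case: (a) a0 a1 => [|[]].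
have trivD : diagram_unknotting_index D (1, n).
  by split=> // mn; apply: lower; apply: rst_refl.
exists (@VirtualKnot (equivalent D) (ex_intro _ D (fun D' => iff_refl _))).
split; first by exists D => //; apply: rst_refl.
by move=> mn [D' DD' [unk _]]; apply: lower unk.
Qed.
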